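(* Let $\{F_n\}_{n=1}^\infty$ be a sequence of disc preserving Möbius transformations, only finitely many of which are rotations, and let $x\in\mathbb{T}$. Denote by $V_n$ the expansion interval of $F_n^{-1}$, by $D_n$ the expansion set of $F_n^{-1}$, and by $d_n$ the center of the disc $D_n$ (for those $n$ for which $F_n$ is not a rotation). Then the following statements are equivalent: 1. The sequence $\{F_n\}_{n=1}^\infty$ represents $x$. 2. For every open interval $I$ on $\mathbb{T}$ containing $x$ we have $\lim_{n\to\infty}(F_n\mu)(I)=1$. 3. There exists a number $c>0$ such that for every open interval $I$ on $\mathbb{T}$ containing $x$ we have $\liminf_{n\to\infty}(F_n\mu)(I)>c$. 4. $\lim_{n\to\infty}d_n=x$. 5. $\lim_{n\to\infty}D_n=\{x\}$. 6. $\lim_{n\to\infty}\overline{V_n}=\{x\}$. 7. For all nonempty compact $K\subseteq \mathrm{Int}(\mathbb{D})$ we have $\lim_{n\to\infty}F_n(K)=\{x\}$. 8. For all $z\in\mathrm{Int}(\mathbb{D})$ we have $\lim_{n\to\infty}F_n(z)=x$. 9. There exists $z\in\mathrm{Int}(\mathbb{D})$ such that $\lim_{n\to\infty}F_n(z)=x$. 10. The sequence $\{F_n\}_{n=1}^\infty$ converges to the constant map $z\mapsto x$ in measure, that is, for all $\varepsilon>0$, $\lim_{n\to\infty}\mu(\{z\in\mathbb{T}:\rho(F_n(z),x)>\varepsilon\})=0$. Here the convergence in (5), (6), (7) is in the Hausdorff metric on nonempty compact subsets of $\mathbb{C}$, $\mathbb{T}$ and $\mathbb{D}$ respectively; in particular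 $E_n\to\{x\}$ iff for every $\varepsilon>0$ there is $n_0$ such that $E_n\subseteq B_\varepsilon(x)$ for all $n>n_0$.
   Context: $\mathbb{T}$ is the unit circle and $\mathbb{D}$ the closed unit disc in $\mathbb{C}$; $\overline{\mathbb{C}}=\mathbb{C}\cup\{\infty\}$. $\mathbb{T}$ carries the metric $\rho$ measuring distance along the circle; $\mu$ is the uniform Borel probability measure on $\mathbb{T}$. A disc preserving Möbius transformation is a map $F(z)=\frac{\alpha z+\beta}{\overline\beta z+\overline\alpha}$ with $\alpha,\beta\in\mathbb{C}$, $|\alpha|^2-|\beta|^2=1$ (equivalently, a Möbius transformation of $\overline{\mathbb{C}}$ with $F(\mathbb{D})=\mathbb{D}$). It is a rotation if $\beta=0$ (i.e. $F(z)=e^{i\phi}z$). Put $F^{\bullet}(x)=|F'(x)|=\frac{1}{|\overline\beta x+\overline\alpha|^2}$ (equal to $+\infty$ at the pole, and to $0$ at $\infty$ when $\beta\ne0$). The expansion interval of $F^{-1}$ is $V=\{x\in\mathbb{T}:(F^{-1})^{\bullet}(x)>1\}$ and the expansion set of $F^{-1}$ is $D=\{x\in\overline{\mathbb{C}}:(F^{-1})^{\bullet}(x)\ge1\}$. If $F$ is not a rotation, $D$ is a closed disc in $\mathbb{C}$ with center $\alpha/\overline\beta$ and radius $1/|\beta|$. For a Borel measure $\nu$ on $\mathbb{T}$, $F\nu$ is the measure $F\nu(E)=\nu(F^{-1}(E))$. The sequence $\{F_n\}$ represents $x\in\mathbb{T}$ if $F_n\mu\to\delta_x$ (Dirac measure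 at $x$) in the weak$^*$ topology, i.e. $\int f\,dF_n\mu\to f(x)$ for every continuous $f:\mathbb{T}\to\mathbb{R}$. *)

(* Defs.v *)
From HB Require Import structures.
From mathcomp Require Import all_boot all_order all_algebra.
From mathcomp Require Import complex ring.
From mathcomp Require Import all_classical all_reals all_analysis.
From mathcomp Require Import measurable_realfun.
Set Implicit Arguments.
Unset Strict Implicit.
Unset Printing Implicit Defensive.
Import Order.TTheory GRing.Theory Num.Theory.
Import numFieldNormedType.Exports.
Local Open Scope classical_set_scope.
Local Open Scope ring_scope.

(* [R[i]^o] rather than [R[i]]: only the former carries the norm topology. *)
Notation C R := (R[i]%C^o).

Section hausdorff.
Context {R : realType} {T : Type} (d : T -> T -> R).

(* Values in [\bar R], so that no boundedness or nonemptiness is needed; for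
   nonempty compact sets of a metric space this is the usual real number. *)
Definition hausdorff_dist (A B : set T) : \bar R :=
  maxe (ereal_sup [set ereal_inf [set (d a b)%:E | b in B] | a in A])
       (ereal_sup [set ereal_inf [set (d a b)%:E | a in A] | b in B]).

Definition hausdorff_cvg (A : nat -> set T) (B : set T) : Prop :=
  hausdorff_dist (A n) B @[n --> \oo] --> 0%E.

End hausdorff.

Section plane.
Context {R : realType}.

(* The norm of [C R] takes its values in [C R] itself; [cabs] is real-valued. *)
Definition cabs (z : C R) : R := complex.Re `|z|.
Definition cdist (z w : C R) : R := cabs (z - w).

Lemma cabsE (z : C R) : `|z| = (cabs z)%:C%C.
Proof. by rewrite /cabs normc_def. Qed.

Definition open_disc : set (C R) := [set z | `|z| < 1].

Definition unit_circle : set (C R) := [set z | `|z| = 1].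

Definition closed_disc_at (c : C R) (r : R) : set (C R) :=
  [set z | cdist z c <= r].

Definition extended_plane := one_point_compactification (C R).

(* The center of a subset of the extended plane that is a closed disc in the
   plane (where it is unique), and 0 for any other set. *)
Definition disc_center (D : set extended_plane) : C R :=
  xget 0 [set c | exists2 r : R, 0 < r & D = Some @` closed_disc_at c r].

(* Forgets only the point at infinity, which belongs to the expansion sets
   (below) of rotations and of no other transformation. *)
Definition finite_part (D : set extended_plane) : set (C R) := Some @^-1` D.

End plane.
Arguments open_disc R : clear implicits.
Arguments extended_plane R : clear implicits.

(* The circle as a type, with the topology induced by the plane. *)
Notation circle R := (set_type (@unit_circle R)).

Section circle.
Context {R : realType}.

Definition cis (t : R) : C R := (cos t +i* sin t)%C.

Lemma cis_unit_circle t : unit_circle (cis t).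
Proof. by rewrite /unit_circle /= /cis normc_def /= cos2Dsin2 sqrtr1. Qed.

Definition expi (t : R) : circle R := SigSub (mem_set (cis_unit_circle t)).

HB.instance Definition _ := isPointed.Build (circle R) (expi 0).

Lemma continuous_cis : continuous cis.
Proof.
move=> t; apply/cvgrPdist_lt => e e0.
have [er e0r] : e = (complex.Re e)%:C%C /\ 0 < complex.Re e.
  by case: e e0 => a b; rewrite ltcE /= => /andP[/eqP -> ->].
pose g s := Num.sqrt ((cos t - cos s) ^+ 2 + (sin t - sin s) ^+ 2).
have gt0 : g t = 0 by rewrite /g !subrr expr0n /= addr0 sqrtr0.
have gc : g s @[s --> t] --> g t.
  apply: (@cvg_comp _ _ _
    (fun s => (cos t - cos s) ^+ 2 + (sin t - sin s) ^+ 2) Num.sqrt);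
    last exact: sqrt_continuous.
  by apply: cvgD; rewrite !expr2; apply: cvgM; apply: cvgB;
    try exact: cvg_cst; [exact: continuous_cos|exact: continuous_cos|
    exact: continuous_sin|exact: continuous_sin].
move/cvgrPdist_lt : gc => /(_ _ e0r); rewrite gt0.
apply: filterS => s; rewrite sub0r normrN ger0_norm ?sqrtr_ge0// => gs.
by rewrite er normc_def /= ltcR.
Qed.

Lemma continuous_expi : continuous expi.
Proof. by apply: continuous_comp_initial; exact: continuous_cis. Qed.

(* [cis t * w] is reached from [w] along an arc of length [`|t|]. *)
Definition arc_dist (z w : circle R) : R :=
  inf [set `|t| | t in [set t : R | \val z = cis t * \val w]].

(* The largest open intervals are the circle minus a point. *)
Definition open_interval (I : set (circle R)) : Prop :=
  exists a b : R, a < b <= a + pi *+ 2 /\ I = expi @` `]a, b[.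

Definition borel_circle := g_sigma_algebraType (@open (circle R)).

Lemma measurable_expi : measurable_fun [set: measurableTypeR R]
  (expi : measurableTypeR R -> borel_circle).
Proof.
apply: (@measurability _ _ _ borel_circle _ _ (@open (circle R)) erefl)
  => _ [U oU <-].
rewrite setTI; apply: open_measurable.
by move/continuousP : continuous_expi; apply.
Qed.

HB.instance Definition _ :=
  isMeasurableFun.Build _ _ _ _ (expi : measurableTypeR R -> borel_circle)
    measurable_expi.

Lemma pi2_gt0 : 0 < pi *+ 2 :> R.
Proof. by rewrite mulrn_wgt0// pi_gt0. Qed.

Definition circle_measure : probability borel_circle R :=
  distribution (uniform_prob pi2_gt0)
    (expi : {mfun measurableTypeR R >-> borel_circle}).

End circle.
Arguments borel_circle R : clear implicits.

Definition weak_star_cvg (R : realType)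
    (nu_ : nat -> set (borel_circle R) -> \bar R)
    (nu : set (borel_circle R) -> \bar R) : Prop :=
  forall f : circle R -> R, continuous f ->
    (\int[nu_ n]_z (f z)%:E)%E @[n --> \oo] --> (\int[nu]_z (f z)%:E)%E.

Lemma continuous_homography (K : numFieldType) (a b c d z : K) :
  c * z + d != 0 -> {for z, continuous (fun w => (a * w + b) / (c * w + d))}.
Proof.
move=> dz; have affine (u v : K) : u * w + v @[w --> z] --> u * z + v.
  have h1 : u * w @[w --> z] --> u * z.
    by apply: (@cvgM K K (nbhs z) _ (cst u) id); [exact: cvg_cst|exact: cvg_id].
  exact: (@cvgD K K K (nbhs z) _ _ _ _ _ h1 (@cvg_cst _ v _ _ _)).
exact: (cvgM (affine a b) (cvgV dz (affine c d))).
Qed.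

(* The disc preserving Moebius transformation
   z |-> (malpha * z + mbeta) / (mbeta^* * z + malpha^* ). *)
Record mobius (R : realType) := Mobius {
  malpha : C R;
  mbeta : C R;
  mobius_norm : `|malpha| ^+ 2 - `|mbeta| ^+ 2 = 1 }.

Section mobius.
Context {R : realType}.
Implicit Types F : mobius R.

Definition mobius_rotation F : Prop := mbeta F = 0.

Definition mobius_den F (z : C R) : C R := (mbeta F)^* * z + (malpha F)^*.

(* Junk value 0 at the pole, which is never in the closed unit disc. *)
Definition mobius_fun F (z : C R) : C R :=
  (malpha F * z + mbeta F) / mobius_den F z.

Lemma mobius_inv_norm F : `|(malpha F)^*| ^+ 2 - `|- mbeta F| ^+ 2 = 1.
Proof. by rewrite norm_conjC normrN mobius_norm. Qed.

Definition mobius_inv F : mobius R := Mobius (mobius_inv_norm F).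

Lemma mobius_den_neq0 F z : `|z| <= 1 -> mobius_den F z != 0.
Proof.
move=> z1; apply/eqP; rewrite /mobius_den => /eqP.
rewrite addr_eq0 => /eqP/(congr1 (fun w : C R => `|w| ^+ 2)).
rewrite normrN normrM !norm_conjC exprMn => ab.
have := mobius_norm F; rewrite -ab => ba1.
have : `|mbeta F| ^+ 2 * `|z| ^+ 2 - `|mbeta F| ^+ 2 <= 0.
  by rewrite subr_le0 ler_piMr ?exprn_ge0// exprn_ile1.
by rewrite ba1 ler10.
Qed.

Lemma mobius_fun_circle F z : unit_circle z -> unit_circle (mobius_fun F z).
Proof.
rewrite /unit_circle /= => z1.
have dz : mobius_den F z != 0 by apply: mobius_den_neq0; rewrite z1.
have -> : mobius_fun F z = z * (mobius_den F z)^* / mobius_den F z.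
  rewrite /mobius_fun /mobius_den; congr (_ / _).
  rewrite rmorphD rmorphM /= !conjCK mulrDr mulrCA -normCK z1 expr1n mulr1.
  by rewrite addrC [z * _]mulrC.
by rewrite !normrM z1 mul1r normfV norm_conjC divff// normr_eq0.
Qed.

Lemma mobius_funK F z : `|z| <= 1 ->
  mobius_fun (mobius_inv F) (mobius_fun F z) = z.
Proof.
move=> /(mobius_den_neq0 F) dz; have ab := mobius_norm F.
rewrite !normCK in ab.
have nE : (malpha F)^* * mobius_fun F z - mbeta F = z / mobius_den F z.
  apply: (mulIf dz); rewrite mulrBl -mulrA !divfK// /mobius_den.
  transitivity (z * (malpha F * (malpha F)^* - mbeta F * (mbeta F)^*));
    [ring|by rewrite ab mulr1].
have dE : mobius_den (mobius_inv F) (mobius_fun F z) = (mobius_den F z)^-1.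
  apply: (mulIf dz); rewrite mulVf// {1}/mobius_den /= rmorphN /= conjCK.
  rewrite mulrDl -mulrA divfK// -ab /mobius_den; ring.
by rewrite {1}/mobius_fun dE invrK /= nE divfK.
Qed.

Definition mobius_circle F (z : circle R) : circle R :=
  SigSub (mem_set (mobius_fun_circle F (set_mem (valP z)))).

Lemma continuous_mobius_circle F : continuous (mobius_circle F).
Proof.
apply: continuous_comp_initial => z.
have cval : (\val w : C R) @[w --> z] --> (\val z : C R).
  exact: (@initial_continuous (circle R) (C R) set_val z).
have dz : mobius_den F (\val z) != 0.
  apply: mobius_den_neq0.
  by have /set_mem := valP z; rewrite /unit_circle /= => ->.
have cF := @continuous_homography R[i]%C (malpha F) (mbeta F) (mbeta F)^*
  (malpha F)^* (\val z) dz.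
exact: (@cvg_comp _ _ _ (fun w : circle R => \val w : C R) (mobius_fun F)
  _ _ _ cval cF).
Qed.

Lemma measurable_mobius_circle F : measurable_fun [set: borel_circle R]
  (mobius_circle F : borel_circle R -> borel_circle R).
Proof.
apply: (@measurability _ _ _ (borel_circle R) _ _ (@open (circle R)) erefl)
  => _ [U oU <-].
rewrite setTI; apply: sub_sigma_algebra.
by move/continuousP : (@continuous_mobius_circle F); apply.
Qed.

HB.instance Definition _ F :=
  isMeasurableFun.Build _ _ _ _
    (mobius_circle F : borel_circle R -> borel_circle R)
    (measurable_mobius_circle F).

Definition mobius_push F (nu : set (borel_circle R) -> \bar R) :
    set (borel_circle R) -> \bar R :=
  pushforward nu (mobius_circle F : borel_circle R -> borel_circle R).

(* |F'(z)| = |mobius_den F z|^-2, as mobius_norm is the determinant of F.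
   At infinity, a non-rotation has derivative 0 and a rotation has constant
   derivative of modulus 1. *)
Definition mobius_dot F (z : extended_plane R) : \bar R :=
  match z with
  | Some z => if mobius_den F z == 0 then +oo%E
              else ((cabs (mobius_den F z) ^+ 2)^-1)%:E
  | None => if mbeta F == 0 then 1%E else 0%E
  end.

Definition expansion_interval F : set (circle R) :=
  [set z | (1 < mobius_dot F (Some (\val z)))%E].

Definition expansion_set F : set (extended_plane R) :=
  [set z | (1 <= mobius_dot F z)%E].

End mobius.

Definition represents (R : realType) (F : nat -> mobius R) (x : circle R) :
    Prop :=
  weak_star_cvg (fun n => mobius_push (F n) circle_measure)
    (\d_(x : borel_circle R)).

(* Main.v *)
Require Import Defs.
From mathcomp Require Import all_boot all_order all_algebra.
From mathcomp Require Import complex ring lra.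
From mathcomp Require Import all_classical all_reals all_analysis.
From mathcomp Require Import measurable_realfun.
Set Implicit Arguments.
Unset Strict Implicit.
Unset Printing Implicit Defensive.
Import Order.TTheory GRing.Theory Num.Theory.
Import numFieldNormedType.Exports.
Local Open Scope classical_set_scope.
Local Open Scope ring_scope.

(** Write w = F(0) = beta / conj(alpha) for the image of the origin, so that
    1 - |w|^2 = 1 / |alpha|^2. The ten conditions are all equivalent to one
    statement about these points: F_n(0) converges to x.

    The geometric conditions are compared with it by explicit estimates.
    - The expansion set of the inverse of F is the disc with center
      d = 1 / conj(w) and squared radius 1 / |beta|^2 = |d|^2 - 1. Hence
      d -> x forces the radius to 0 (the lemma
      [disc_center_expansion_set_cvg]), and the expansion interval is the part
      of the circle inside this disc.
    - With k = w / |w|, the expansion interval consists of the k * u with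
      |u| = 1 and Re u > |w|. If it shrinks to x, then k is near x, and the
      point u with Re u half-way between |w| and 1 has to be near 1, so |w| is
      near 1: thus w is near x ([expansion_interval_center_cvg]).
    - For |z| < 1 one has |F(z) - w| <= (1 - |w|^2) / (1 - |z|), while
      1 - |F(z)|^2 and 1 - |w|^2 are comparable with constants depending on z
      only. As |w| -> 1 when w -> x, all orbits of interior points approach x
      together, uniformly on compact sets, as soon as one of them does.

    The measure theoretic conditions rest on a single identity, valid for z
    and y on the circle ([mobius_chord]):
      |z - y| |F(z) - w| |F(y) - w| = (1 - |w|^2) |F(z) - F(y)|.
    It shows that a set of points of the circle whose images stay away from w
    has a small diameter in each of two situations: when the images are close
    to each other, and when |w| is close to 1. A set of small diameter has
    small uniform measure ([circle_measure_small_diam]).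
    - In the first situation, if w_n is not near x, then the preimage under
      F_n of a short interval around x has small measure, which contradicts
      any positive lower bound c on the limits inferior
      ([limn_einf_center_cvg]).
    - In the second, if w_n -> x, then the points mapped away from x form a
      set of small measure, which is convergence in measure
      ([center_cvg_in_measure]). Almost everywhere convergence would fail: the
      exceptional set can wander around the circle with n.

    Convergence in measure gives weak* convergence by splitting the integral
    of |f o F_n - f(x)|, and weak* convergence gives the convergence of the
    masses of intervals by testing against a continuous bump function. *)

(** * The modulus as a real number *)

Section modulus.
Context {R : realType}.
Implicit Types z w : C R.

Lemma cabs_ge0 z : 0 <= cabs z.
Proof. by rewrite -lecR -cabsE normr_ge0. Qed.

Lemma cabsM z w : cabs (z * w) = cabs z * cabs w.
Proof. by apply: complexI; rewrite rmorphM /= -!cabsE normrM. Qed.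

Lemma cabsN z : cabs (- z) = cabs z.
Proof. by rewrite /cabs normrN. Qed.

Lemma cabs_conj z : cabs z^* = cabs z.
Proof. by rewrite /cabs norm_conjC. Qed.

Lemma cabsV z : cabs z^-1 = (cabs z)^-1.
Proof. by apply: complexI; rewrite fmorphV /= -!cabsE normfV. Qed.

Lemma cabsD z w : cabs (z + w) <= cabs z + cabs w.
Proof. by rewrite -lecR rmorphD /= -!cabsE; exact: ler_normD. Qed.

Lemma cabsBC z w : cabs (z - w) = cabs (w - z).
Proof. by rewrite -cabsN opprB. Qed.

Lemma cabs_triangle y z w : cabs (z - w) <= cabs (z - y) + cabs (y - w).
Proof. by have -> : z - w = (z - y) + (y - w); [ring|exact: cabsD]. Qed.

Lemma cabs0 : cabs (0 : C R) = 0.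
Proof. by rewrite /cabs normr0. Qed.

Lemma cabs1 : cabs (1 : C R) = 1.
Proof. by rewrite /cabs normr1. Qed.

Lemma cabs_eq0 z : (cabs z == 0) = (z == 0).
Proof. by rewrite -[RHS]normr_eq0 cabsE -(inj_eq (@complexI R)). Qed.

Lemma cabs_gt0 z : (0 < cabs z) = (z != 0).
Proof. by rewrite lt0r cabs_eq0 cabs_ge0 andbT. Qed.

Lemma cabsR (r : R) : cabs (r%:C%C : C R) = `|r|.
Proof. by rewrite /cabs normc_def /= expr0n /= addr0 sqrtr_sqr. Qed.

Lemma sqr_cabs z : cabs z ^+ 2 = complex.Re z ^+ 2 + complex.Im z ^+ 2.
Proof. by apply: complexI; rewrite rmorphXn /= -cabsE -add_Re2_Im2. Qed.

Lemma sqr_cabsE z : (cabs z ^+ 2)%:C%C = z * z^*.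
Proof. by rewrite rmorphXn /= -cabsE normCK. Qed.

Lemma cabs_dist_ge z w : cabs z - cabs w <= cabs (z - w).
Proof. by rewrite lerBlDr -[in leLHS](subrK w z); exact: cabsD. Qed.

Lemma unit_circleP z : unit_circle z <-> cabs z = 1.
Proof.
by rewrite /unit_circle /= cabsE; split => [/(@complexI R)|->].
Qed.

Lemma open_discP z : open_disc R z <-> cabs z < 1.
Proof. by rewrite /open_disc /= cabsE -ltcR. Qed.

Lemma cabs_circle (z : circle R) : cabs (\val z) = 1.
Proof. by apply/unit_circleP; exact: (set_mem (valP z)). Qed.

Lemma normC_lt z (e : C R) : 0 < e -> (`|z| < e) = (cabs z < complex.Re e).
Proof.
case: e => a b; rewrite ltcE /= => /andP[/eqP -> a0].
by rewrite cabsE ltcE /= eqxx.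
Qed.

Lemma ReC_gt0 (e : C R) : 0 < e -> 0 < complex.Re e.
Proof. by rewrite ltcE /= => /andP[]. Qed.

(** The norm of the plane takes values in the plane; this restates convergence
    with real radii. *)
Lemma cvg_cabsP (T : Type) (G : set_system T) {FG : Filter G} (u : T -> C R) (l : C R) :
  (u t @[t --> G] --> l) <->
  (forall e : R, 0 < e -> \forall t \near G, cabs (u t - l) < e).
Proof.
split=> [/cvgrPdist_lt ul e e0|ul].
  have e0' : 0 < (e%:C%C : C R) by rewrite ltcR.
  apply: filterS (ul _ e0') => t; rewrite normC_lt//= cabsBC//.
apply/cvgrPdist_lt => e e0; apply: filterS (ul _ (ReC_gt0 e0)) => t.
by rewrite normC_lt// cabsBC.
Qed.

End modulus.

(** * Arcs and chords of the circle *)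

Section arcs.
Context {R : realType}.
Implicit Types z w : circle R.

Lemma ReMconj (z w : C R) : complex.Re (z * w^*) =
  complex.Re z * complex.Re w + complex.Im z * complex.Im w.
Proof. by case: z w => [a b] [c d] /=; rewrite mulrN opprK. Qed.

(** The cosine of the angle between two points of the circle. It is polynomial
    in the coordinates, hence continuous, and determines both the arc and the
    chord; all comparisons between distances go through it. *)
Definition circle_cos z w : R := complex.Re (\val z * (\val w)^*).

Lemma circle_Re2Im2 z : complex.Re (\val z) ^+ 2 + complex.Im (\val z) ^+ 2 = 1.
Proof. by rewrite -sqr_cabs cabs_circle expr1n. Qed.

Lemma sqr_chord z w : cabs (\val z - \val w) ^+ 2 = 2 - circle_cos z w *+ 2.
Proof.
rewrite sqr_cabs /circle_cos ReMconj; have := circle_Re2Im2 z; have := circle_Re2Im2 w.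
case: (\val z) (\val w) => [a b] [c d] /= h1 h2.
transitivity ((c ^+ 2 + d ^+ 2) + (a ^+ 2 + b ^+ 2) - (a * c + b * d) *+ 2); first ring.
by rewrite h1 h2.
Qed.

Lemma circle_cos_bounds z w : -1 <= circle_cos z w <= 1.
Proof.
have := sqr_ge0 (cabs (\val z - \val w)); rewrite sqr_chord => h1.
have := sqr_ge0 (cabs (\val z + \val w)).
have -> : cabs (\val z + \val w) ^+ 2 = 2 + circle_cos z w *+ 2.
  rewrite sqr_cabs /circle_cos ReMconj; have := circle_Re2Im2 z; have := circle_Re2Im2 w.
  case: (\val z) (\val w) {h1} => [a b] [c d] /= h1 h2.
  transitivity ((c ^+ 2 + d ^+ 2) + (a ^+ 2 + b ^+ 2) + (a * c + b * d) *+ 2); first ring.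
  by rewrite h1 h2.
by move=> h2; apply/andP; split; lra.
Qed.

Lemma circle_mul_conj z : \val z * (\val z)^* = 1.
Proof. by rewrite -sqr_cabsE cabs_circle expr1n. Qed.

(** An angle of least absolute value; its sign is that of the imaginary part. *)
Lemma cis_acos (u : C R) : cabs u = 1 ->
  exists2 t, `|t| = acos (complex.Re u) & u = cis t.
Proof.
move=> u1; have := sqr_cabs u; rewrite u1 expr1n; case: u {u1} => a b /= ab.
have ab1 : -1 <= a <= 1.
  by rewrite -ler_norml -(@expr_le1 _ 2)// -normrX ger0_norm ?sqr_ge0// ab lerDl sqr_ge0.
have a0 := acos_ge0 ab1.
have sa : sin (acos a) = `|b|.
  rewrite sin_acos// (_ : 1 - a ^+ 2 = b ^+ 2) ?sqrtr_sqr//.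
  by rewrite ab addrAC subrr add0r.
have [b0|b0] := leP 0 b.
  exists (acos a); first by rewrite ger0_norm.
  by rewrite /cis acosK// sa ger0_norm.
exists (- acos a); first by rewrite normrN ger0_norm.
by rewrite /cis cosN sinN acosK// sa ltr0_norm// opprK.
Qed.

Lemma acos_cos_le (t : R) : acos (cos t) <= `|t|.
Proof.
rewrite -(cos_norm t).
have [tpi|/ltW tpi] := leP `|t| pi; first by rewrite cosK// in_itv/= normr_ge0.
by rewrite (le_trans _ tpi)// acos_lepi// cos_geN1 cos_le1.
Qed.

Lemma circle_cos_cis (t : R) z w : \val z = cis t * \val w -> circle_cos z w = cos t.
Proof.
by rewrite /circle_cos => ->; rewrite -mulrA circle_mul_conj mulr1.
Qed.

(** The infimum that defines the arc distance is attained, at the angle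
    provided by [cis_acos]. *)
Lemma arc_distE z w : arc_dist z w = acos (circle_cos z w).
Proof.
pose S := [set `|t| | t in [set t : R | \val z = cis t * \val w]].
have lbS : lbound S (acos (circle_cos z w)).
  by move=> _ [t /= zt <-]; rewrite (circle_cos_cis zt) acos_cos_le.
have [t tE zt] : exists2 t, `|t| = acos (circle_cos z w) & \val z * (\val w)^* = cis t.
  by apply: cis_acos; rewrite cabsM cabs_conj !cabs_circle mulr1.
have Sac : S (acos (circle_cos z w)).
  by exists t => //=; rewrite -zt -mulrA [_^* * _]mulrC circle_mul_conj mulr1.
apply/eqP; rewrite eq_le; apply/andP; split.
  by apply: (ge_inf _ Sac); exists (acos (circle_cos z w)).
by apply: lb_le_inf lbS; exists (acos (circle_cos z w)); exact: Sac.
Qed.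

Lemma arc_dist_ge0 z w : 0 <= arc_dist z w.
Proof. by rewrite arc_distE acos_ge0// circle_cos_bounds. Qed.

Lemma arc_dist_lepi z w : arc_dist z w <= pi.
Proof. by rewrite arc_distE acos_lepi// circle_cos_bounds. Qed.

Lemma cos_arc_dist z w : cos (arc_dist z w) = circle_cos z w.
Proof. by rewrite arc_distE acosK// in_itv/= circle_cos_bounds. Qed.

Lemma arc_dist_lt z w (e : R) : 0 <= e <= pi ->
  (arc_dist z w < e) = (cos e < circle_cos z w).
Proof.
move=> epi; rewrite -cos_arc_dist ltr_cos// in_itv/=//.
by rewrite arc_dist_ge0 arc_dist_lepi.
Qed.

Lemma arc_dist_gt z w (e : R) : 0 <= e <= pi ->
  (e < arc_dist z w) = (circle_cos z w < cos e).
Proof.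
move=> epi; rewrite -cos_arc_dist ltr_cos// in_itv/=//.
by rewrite arc_dist_ge0 arc_dist_lepi.
Qed.

Lemma cos_lt1 (e : R) : 0 < e <= pi -> cos e < 1.
Proof.
move=> /andP[e0 epi]; rewrite -[ltRHS]cos0 ltr_cos// in_itv/= ?lexx ?pi_ge0//.
by rewrite ltW.
Qed.

(** Chords and arcs are uniformly comparable: both are functions of
    [circle_cos], by [sqr_chord] and [cos_arc_dist]. *)
Lemma arc_small_of_chord_small (e : R) : 0 < e ->
  exists2 h : R, 0 < h &
    forall z w, cabs (\val z - \val w) < h -> arc_dist z w < e.
Proof.
move=> e0; pose e' := Num.min e pi.
have e'b : 0 < e' <= pi by rewrite lt_min e0 pi_gt0/= ge_min lexx orbT.
have ce := cos_lt1 e'b.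
exists (Num.sqrt (2 - cos e' *+ 2)).
  by rewrite sqrtr_gt0; lra.
move=> z w zw; apply: (@lt_le_trans _ _ e'); last by rewrite ge_min lexx.
rewrite arc_dist_lt; last by case/andP : e'b => /ltW-> ->.
have : cabs (\val z - \val w) ^+ 2 < 2 - cos e' *+ 2.
  rewrite -[ltRHS]sqr_sqrtr; last by lra.
  by rewrite ltr_pXn2r// nnegrE ?sqrtr_ge0 ?cabs_ge0.
by rewrite sqr_chord; lra.
Qed.

Lemma chord_small_of_arc_small (h : R) : 0 < h ->
  exists2 e : R, 0 < e <= pi &
    forall z w, arc_dist z w < e -> cabs (\val z - \val w) < h.
Proof.
move=> h0; pose h' := Num.min h 1.
have h'0 : 0 < h' by rewrite lt_min h0 ltr01.
have h'1 : h' <= 1 by rewrite ge_min lexx orbT.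
have hb : -1 <= 1 - h' ^+ 2 / 2 < 1.
  have : h' ^+ 2 <= 1 by rewrite expr_le1// ltW.
  have : 0 < h' ^+ 2 by rewrite exprn_gt0.
  by move=> *; apply/andP; split; lra.
have hb' : -1 <= 1 - h' ^+ 2 / 2 <= 1 by case/andP : hb => -> /ltW.
have ae : 0 < acos (1 - h' ^+ 2 / 2) <= pi by rewrite acos_gt0// acos_lepi.
exists (acos (1 - h' ^+ 2 / 2)) => // z w.
rewrite arc_dist_lt; last by case/andP : ae => /ltW-> ->.
rewrite acosK ?in_itv//= => hz.
apply: (@lt_le_trans _ _ h'); last by rewrite ge_min lexx.
rewrite -(@ltr_pXn2r _ 2)// ?nnegrE ?cabs_ge0 ?ltW// sqr_chord; lra.
Qed.

Lemma arc_dist_refl z : arc_dist z z = 0.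
Proof.
apply/eqP; rewrite eq_le arc_dist_ge0 andbT.
apply/ler_addgt0Pl => e e0; rewrite addr0.
have [h h0 hz] := arc_small_of_chord_small e0.
by apply/ltW/hz; rewrite subrr cabs0.
Qed.

Lemma continuous_circle_cos w : continuous (fun z => circle_cos z w).
Proof.
move=> z; apply/(@cvgrPdist_lt _ _ _ (nbhs z) (nbhs_filter z)) => e e0.
have cval : (\val w : C R) @[w --> z] --> (\val z : C R).
  exact: (@initial_continuous (circle R) (C R) set_val z).
have := (@cvg_cabsP R (circle R) (nbhs z) (nbhs_filter z) _ _).1 cval _ e0; apply: filterS => y yz.
apply: le_lt_trans yz; rewrite cabsBC /circle_cos -raddfB/= -mulrBl.
have := normc_ge_Re ((\val z - \val y) * (\val w)^*).
by rewrite cabsE lecR cabsM cabs_conj cabs_circle mulr1.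
Qed.

Lemma open_arc_dist_lt w (e : R) : e <= pi -> open [set z | arc_dist z w < e].
Proof.
move=> epi; have [e0|e0] := leP 0 e; last first.
  rewrite (_ : mkset _ = set0); first exact: open0.
  by rewrite -subset0 => z /=; rewrite ltNge (le_trans (ltW e0))// arc_dist_ge0.
rewrite (_ : mkset _ = (fun z => circle_cos z w) @^-1` [set y | cos e < y]).
  by apply: open_comp => [z _|]; [exact: continuous_circle_cos|exact: open_gt].
by apply/seteqP; split => z /=; rewrite arc_dist_lt// e0.
Qed.

Lemma open_arc_dist_gt w (e : R) : open [set z | e < arc_dist z w].
Proof.
have [e0|e0] := ltP e 0.
  rewrite (_ : mkset _ = setT); first exact: openT.
  by rewrite -subTset => z _ /=; rewrite (lt_le_trans e0)// arc_dist_ge0.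
have [epi|epi] := leP e pi; last first.
  rewrite (_ : mkset _ = set0); first exact: open0.
  by rewrite -subset0 => z /=; rewrite ltNge (le_trans _ (ltW epi))// arc_dist_lepi.
rewrite (_ : mkset _ = (fun z => circle_cos z w) @^-1` [set y | y < cos e]).
  by apply: open_comp => [z _|]; [exact: continuous_circle_cos|exact: open_lt].
by apply/seteqP; split => z /=; rewrite arc_dist_gt// e0.
Qed.

Lemma circle_expi z : exists t, z = expi t.
Proof.
have [t _ zt] := cis_acos (cabs_circle z).
by exists t; apply/val_inj.
Qed.

Lemma cisD (s t : R) : cis (s + t) = cis s * cis t.
Proof. by rewrite /cis cosD sinD; congr (_ +i* _)%C; rewrite addrC. Qed.

Lemma arc_dist_expi_lt z (t e : R) :
  arc_dist z (expi t) < e -> exists2 s, `|s - t| < e & z = expi s.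
Proof.
have [s sE zs] : exists2 s, `|s| = acos (circle_cos z (expi t)) &
    \val z * (\val (expi t))^* = cis s.
  by apply: cis_acos; rewrite cabsM cabs_conj !cabs_circle mulr1.
rewrite arc_distE -sE => se; exists (s + t); first by rewrite addrK.
apply/val_inj; rewrite /= cisD -zs -mulrA -[cis t]/(\val (expi t)).
by rewrite [_^* * _]mulrC circle_mul_conj mulr1.
Qed.

Lemma arc_dist_expi_le (s t : R) : arc_dist (expi s) (expi t) <= `|s - t|.
Proof.
rewrite arc_distE (@circle_cos_cis (s - t)) ?acos_cos_le//.
by rewrite /= -cisD subrK.
Qed.

(** Arcs centered at a point are a basis of its open intervals; together with
    [arc_open_interval], this reduces the statements about intervals to
    statements about arcs. *)
Lemma open_interval_arc (I : set (circle R)) w : open_interval I -> I w ->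
  exists2 e : R, 0 < e <= pi & [set z | arc_dist z w < e] `<=` I.
Proof.
move=> [a [b [ab ->]]] [t /=]; rewrite in_itv/= => /andP[at_ tb] <-.
exists (Num.min pi (Num.min (t - a) (b - t))).
  by rewrite !lt_min ?subr_gt0 at_ tb pi_gt0/= ge_min lexx.
move=> z /= /arc_dist_expi_lt[s + ->]; rewrite !lt_min ltr_norml => /and3P[_ h1 h2].
by exists s => //=; rewrite in_itv/=; move: h1 h2; rewrite !ltr_norml; lra.
Qed.

Lemma open_interval_open (I : set (circle R)) : open_interval I -> open I.
Proof.
move=> oI; rewrite openE => z Iz; have [e /andP[e0 epi] eI] := open_interval_arc oI Iz.
rewrite /interior nbhsE; exists [set y | arc_dist y z < e] => //.
by split; [exact: open_arc_dist_lt|rewrite /= arc_dist_refl].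
Qed.

Lemma arc_open_interval w (e : R) : 0 < e <= pi ->
  open_interval [set z | arc_dist z w < e].
Proof.
move=> /andP[e0 epi]; have [t ->] := circle_expi w.
exists (t - e), (t + e); split; first by apply/andP; split; lra.
apply/seteqP; split => [z /= /arc_dist_expi_lt[s + ->]|].
  by rewrite ltr_norml => ?; exists s => //=; rewrite in_itv/=; lra.
move=> _ [s + <-]; rewrite /= in_itv/= => ste.
by apply: le_lt_trans (arc_dist_expi_le _ _) _; rewrite ltr_norml; lra.
Qed.

End arcs.

(** * Convergence criteria *)

Section limits.
Context {R : realType}.

Lemma cvge_finP (u : nat -> \bar R) (l : R) :
  (u n @[n --> \oo] --> l%:E) <->
  (forall e : R, 0 < e ->
    \forall n \near \oo, ((l - e)%:E <= u n <= (l + e)%:E)%E).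
Proof.
split=> [/fine_cvgP[fu /cvgrPdist_le ul] e e0|ul].
  apply: filterS2 fu (ul _ e0) => n fn /=.
  by rewrite distrC ler_distl -[in X in _ -> X](fineK fn) !lee_fin.
apply/fine_cvgP; split.
  apply: filterS (ul 1 ltr01) => n /andP[h1 h2].
  by rewrite fin_numElt (lt_le_trans _ h1) ?ltNyr// (le_lt_trans h2) ?ltry.
apply/cvgrPdist_le => e e0; apply: filterS (ul _ e0) => n /andP[h1 h2].
have fn : u n \is a fin_num.
  by rewrite fin_numElt (lt_le_trans _ h1) ?ltNyr// (le_lt_trans h2) ?ltry.
by move: h1 h2; rewrite /= distrC ler_distl -{1 2}(fineK fn) !lee_fin => -> ->.
Qed.

Lemma near_not_finite (S : set nat) : finite_set S -> \forall n \near \oo, ~ S n.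
Proof.
move=> /finite_seqP[s ->]; exists (\max_(i <- s) i).+1 => // n /= sn ns.
by move: sn; rewrite ltnNge leq_bigmax_seq.
Qed.

Lemma limn_einf_gt (u : nat -> \bar R) (c : \bar R) :
  (c < limn_einf u)%E -> \forall n \near \oo, (c < u n)%E.
Proof.
rewrite limn_einf_lim (cvg_lim _ (@cvg_einfs_sup R u))//.
move=> /ereal_sup_gt[_ [N _ <-] cN]; exists N => // n /= Nn.
by apply: lt_le_trans cN _; apply: ereal_inf_lbound; exists n.
Qed.

(** Nonemptiness makes the distance from x to A n at most the distance from x
    to the points of A n; it would be +oo for an empty set. *)
Lemma hausdorff_cvg1P (T : Type) (d : T -> T -> R) (A : nat -> set T) (x : T) :
  (forall y z, 0 <= d y z) -> (\forall n \near \oo, A n !=set0) ->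
  hausdorff_cvg d A [set x] <->
  forall e : R, 0 < e -> \forall n \near \oo, forall a, A n a -> d a x < e.
Proof.
move=> d0 An0; split=> [/cvge_finP Ax e e0|Ax].
  have e20 : 0 < e / 2 by rewrite divr_gt0.
  apply: filterS (Ax _ e20) => n /andP[_]; rewrite add0r => + a Aa.
  rewrite /hausdorff_dist ge_max => /andP[+ _].
  move=> /(le_trans (ereal_sup_ubound _)) => /(_ (d a x)%:E).
  rewrite lee_fin => /(_ _)/le_lt_trans; apply; last by rewrite ltr_pdivrMr// ltr_pMr// ltr1n.
  by exists a => //; rewrite image_set1 ereal_inf1.
apply/cvge_finP => e e0; apply: filterS2 An0 (Ax _ e0) => n [a0 Aa0] Ae.
rewrite sub0r add0r; apply/andP; split.
  apply: (@le_trans _ _ 0%E); first by rewrite lee_fin oppr_le0 ltW.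
  rewrite /hausdorff_dist le_max; apply/orP; left.
  apply: (le_trans _ (ereal_sup_ubound _)); last by exists a0.
  by rewrite image_set1 ereal_inf1 lee_fin.
rewrite /hausdorff_dist ge_max; apply/andP; split; apply: ge_ereal_sup.
  by move=> _ [a Aa <-]; rewrite image_set1 ereal_inf1 lee_fin ltW// Ae.
move=> _ [_ -> <-]; apply: (@le_trans _ _ (d a0 x)%:E); last by rewrite lee_fin ltW// Ae.
by apply: ereal_inf_lbound; exists a0.
Qed.

End limits.

(** * The uniform measure of arcs *)

Section uniform_measure.
Context {R : realType}.
Implicit Types w z : circle R.
Local Notation mu := (@circle_measure R).

Lemma measurable_open_circle (U : set (circle R)) : open U ->
  measurable (U : set (borel_circle R)).
Proof. exact: sub_sigma_algebra. Qed.

Lemma measurable_continuous_circle (f : circle R -> R) : continuous f ->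
  measurable_fun [set: borel_circle R] (f : borel_circle R -> R).
Proof.
move=> cf; apply: (measurability _ (RGenOInfty.measurableE R)) => //.
move=> _ [_ [a ->] <-]; rewrite setTI; apply: measurable_open_circle.
by move/continuousP : cf; apply; exact: interval_open.
Qed.

Lemma circle_expi_0pi2 z : exists2 s, 0 <= s <= pi *+ 2 & z = expi s.
Proof.
have [t tE zt] := cis_acos (cabs_circle z).
have tpi : `|t| <= pi.
  rewrite tE acos_lepi//; rewrite -ler_norml -(@expr_le1 _ 2)// -normrX.
  by rewrite ger0_norm ?sqr_ge0// -(circle_Re2Im2 z) lerDl sqr_ge0.
have [t0|t0] := leP 0 t.
  exists t; last exact/val_inj.
  move: tpi; rewrite ger0_norm// => tpi; have := @pi_gt0 R; lra.
exists (t + pi *+ 2); first by move: tpi; rewrite ltr0_norm//; have := @pi_gt0 R; lra.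
by apply/val_inj; rewrite zt /= /cis cosD2pi sinD2pi.
Qed.

(** The constant is crude by a factor 3: in [0, 2 pi] the arc lifts to a subset
    of three intervals of length 2e, centered at an argument s of w and at its
    two translates by 2 pi. *)
Lemma circle_measure_arc_le w (e : R) : 0 <= e <= pi ->
  (mu [set z | arc_dist z w < e]%R <= (3 * e / pi)%:E)%E.
Proof.
move=> /andP[e0 epi]; have [s s02 ->] := circle_expi_0pi2 w.
have mA : measurable ([set z | arc_dist z (expi s) < e] : set (borel_circle R)).
  by apply: measurable_open_circle; exact: open_arc_dist_lt.
pose A := expi @^-1` [set z | arc_dist z (expi s) < e] : set (measurableTypeR R).
pose J (k : R) : set (measurableTypeR R) := `]k - e, k + e[%classic.
have mJ k : measurable (J k) by exact: measurable_itv.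
have lJ k : (lebesgue_measure (J k) <= (e *+ 2)%:E)%E.
  rewrite lebesgue_measure_itv/= lte_fin; case: ifPn => _.
    by rewrite -EFinB lee_fin; lra.
  by rewrite lee_fin mulrn_wge0.
have mA' : measurable A.
  by rewrite -[A]setTI; apply: measurable_expi.
have mAI : measurable (A `&` `[0, pi *+ 2]) by apply: measurableI.
have AJ : A `&` `[0, pi *+ 2] `<=` J s `|` (J (s + pi *+ 2) `|` J (s - pi *+ 2)).
  move=> t []; rewrite /A /preimage /mkset /= arc_dist_lt ?e0// (@circle_cos_cis _ (t - s)); last first.
    by rewrite /= -cisD subrK.
  rewrite /J/= !in_itv/= => cts t02.
  have [ts|ts] := ltP `|t - s| e.
    by left; move: ts; rewrite ltr_norml; lra.
  right; have pi0 := @pi_gt0 R.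
  (* cos is decreasing on [0, pi], so cos (t - s) > cos e leaves only angles
     beyond pi, which are reflected by t - s |-> 2 pi - |t - s| *)
  have tspi : pi < `|t - s|.
    rewrite ltNge; apply/negP => tspi; move: cts; rewrite -[cos (t - s)]cos_norm.
    by rewrite ltr_cos ?in_itv/= ?e0 ?normr_ge0// ltNge ts.
  have ts2 : `|t - s| <= pi *+ 2 by rewrite ler_norml; lra.
  have : pi *+ 2 - `|t - s| < e.
    have : cos e < cos (pi *+ 2 - `|t - s|).
      by rewrite -(cosN (pi *+ 2 - _)) opprB -(cosD2pi (_ - pi *+ 2)) subrK cos_norm.
    by rewrite ltr_cos ?in_itv/=; lra.
  have [ts0|ts0] := leP 0 (t - s).
    by rewrite ger0_norm// in tspi ts2 *; left; lra.
  by rewrite ltr0_norm// in tspi ts2 *; right; lra.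
have -> : mu [set z | arc_dist z (expi s) < e] = uniform_prob (@pi2_gt0 R) A by [].
rewrite /uniform_prob integral_uniform_pdf.
rewrite (eq_integral (fun=> (pi *+ 2)^-1%:E)); last first.
  move=> t; rewrite inE => -[_ /=]; rewrite in_itv/= => t02.
  by rewrite /uniform_pdf t02 subr0.
rewrite integral_cst//.
apply: (@le_trans _ _ ((pi *+ 2)^-1%:E * (e *+ 6)%:E)%E); last first.
  rewrite -EFinM lee_fin; have pi0 := @pi_gt0 R.
  rewrite le_eqVlt; apply/orP; left; apply/eqP.
  by move: pi pi0 => p p0; field; rewrite gt_eqF.
apply: lee_wpmul2l; first by rewrite lee_fin invr_ge0 mulrn_wge0// pi_ge0.
have -> : (e *+ 6)%:E = ((e *+ 2)%:E + ((e *+ 2)%:E + (e *+ 2)%:E))%E.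
  by rewrite -!EFinD -!mulrnDr.
apply: (@le_trans _ _ (lebesgue_measure (J s `|` (J (s + pi *+ 2) `|` J (s - pi *+ 2))))).
  by apply: le_measure; rewrite ?inE//; do 2 apply: measurableU => //.
apply: le_trans; first by apply: measureU2 => //; exact: measurableU.
apply: leeD; first exact: lJ.
apply: le_trans; first by apply: measureU2.
by apply: leeD; exact: lJ.
Qed.

Lemma circle_measure_arc_small (c : R) : 0 < c ->
  exists2 e : R, 0 < e <= pi &
    forall w, (mu [set z | arc_dist z w < e]%R <= c%:E)%E.
Proof.
move=> c0; have pi0 := @pi_gt0 R.
have e0 : 0 < Num.min pi (c * pi / 3) <= pi.
  by rewrite lt_min pi0 ge_min lexx !mulr_gt0.
exists (Num.min pi (c * pi / 3)) => // w.
have /andP[/ltW e0' epi] := e0.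
apply: (le_trans (circle_measure_arc_le _ _)); first by rewrite e0'.
rewrite lee_fin ler_pdivrMr// mulrC -ler_pdivlMr//.
by rewrite ge_min lexx orbT.
Qed.

Lemma nbhs_circleP w (A : set (circle R)) : nbhs w A <->
  exists2 e : R, 0 < e <= pi & [set z | arc_dist z w < e] `<=` A.
Proof.
split.
  rewrite nbhsE => -[U [[V oV VU] Uw] UA].
  have Vw : V (\val w) by rewrite -[V _]/((set_val @^-1` V) w) VU.
  have /nbhs_ballP[h h0 hV] : nbhs (\val w : C R) V by exact: open_nbhs_nbhs.
  have [e e0 eh] := chord_small_of_arc_small (ReC_gt0 h0).
  exists e => // z /eh zw; apply: UA; rewrite -VU; apply: hV.
  by rewrite /ball/= normC_lt// cabsBC.
move=> [e /andP[e0 epi] eA]; rewrite nbhsE; exists [set z | arc_dist z w < e] => //.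
by split; [exact: open_arc_dist_lt|rewrite /= arc_dist_refl].
Qed.

(** The circle is the image of the compact interval [0, 2 pi]. *)
Lemma continuous_circle_bounded (f : circle R -> R) : continuous f ->
  exists2 M : R, 0 <= M & forall z, `|f z| <= M.
Proof.
move=> cf.
have cg : {within `[0, pi *+ 2]%classic, continuous (fun t : R => `|f (expi t)|)}.
  apply: continuous_subspaceT => t; apply: cvg_norm.
  by apply: cvg_comp; [exact: continuous_expi|exact: cf].
have [c _ cM] := EVT_max (ltW (@pi2_gt0 R)) cg.
exists `|f (expi c)| => // z; have [s s02 ->] := circle_expi_0pi2 z.
by apply: cM; rewrite in_itv.
Qed.

End uniform_measure.

(** * Disc preserving transformations and their value at the origin *)

Section moebius.
Context {R : realType}.
Implicit Types (F : mobius R) (z y : C R).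

Lemma mobius_detE F : malpha F * (malpha F)^* - mbeta F * (mbeta F)^* = 1.
Proof. by rewrite -!normCK mobius_norm. Qed.

Lemma sqr_malpha F : cabs (malpha F) ^+ 2 = 1 + cabs (mbeta F) ^+ 2.
Proof.
apply: complexI; rewrite rmorphD rmorph1 /= !sqr_cabsE.
by rewrite -(mobius_detE F) subrK.
Qed.

Lemma malpha_ge1 F : 1 <= cabs (malpha F).
Proof. by rewrite -(@expr_ge1 _ 2)// ?cabs_ge0// sqr_malpha lerDl sqr_ge0. Qed.

Lemma malpha_gt0 F : 0 < cabs (malpha F).
Proof. exact: lt_le_trans (malpha_ge1 F). Qed.

Lemma mbeta_lt_malpha F : cabs (mbeta F) < cabs (malpha F).
Proof.
by rewrite -(@ltr_pXn2r _ 2)// ?nnegrE ?cabs_ge0// sqr_malpha ltrDr.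
Qed.

Lemma mobius_funB F z y : cabs z <= 1 -> cabs y <= 1 ->
  mobius_fun F z - mobius_fun F y = (z - y) / (mobius_den F z * mobius_den F y).
Proof.
move=> z1 y1.
have dz : mobius_den F z != 0 by apply: mobius_den_neq0; rewrite cabsE lecR.
have dy : mobius_den F y != 0 by apply: mobius_den_neq0; rewrite cabsE lecR.
rewrite /mobius_fun -[in RHS](mulr1 (z - y)) -(mobius_detE F).
move: dz dy; rewrite /mobius_den => dz dy.
by field; rewrite dz dy.
Qed.

Lemma mobius_den0 F : mobius_den F 0 = (malpha F)^*.
Proof. by rewrite /mobius_den mulr0 add0r. Qed.

Lemma mobius_fun0 F : mobius_fun F 0 = mbeta F / (malpha F)^*.
Proof. by rewrite /mobius_fun mobius_den0 mulr0 add0r. Qed.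

Lemma cabs_mobius_fun0 F :
  cabs (mobius_fun F 0) = cabs (mbeta F) / cabs (malpha F).
Proof. by rewrite mobius_fun0 cabsM cabsV cabs_conj. Qed.

Lemma mobius_fun0_lt1 F : cabs (mobius_fun F 0) < 1.
Proof.
by rewrite cabs_mobius_fun0 ltr_pdivrMr ?malpha_gt0// mul1r mbeta_lt_malpha.
Qed.

Lemma onem_sqr_mobius_fun0 F :
  1 - cabs (mobius_fun F 0) ^+ 2 = (cabs (malpha F) ^+ 2)^-1.
Proof.
have a0 : cabs (malpha F) != 0 by rewrite gt_eqF// malpha_gt0.
have -> : 1 = (cabs (malpha F) ^+ 2) / (cabs (malpha F) ^+ 2) :> R.
  by rewrite divff// sqrf_eq0.
rewrite cabs_mobius_fun0 expr_div_n -mulrBl sqr_malpha addrK.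
by rewrite div1r.
Qed.

Lemma cabs_mobius_funB0 F z : cabs z <= 1 -> cabs (mobius_fun F z - mobius_fun F 0) =
  cabs z / (cabs (mobius_den F z) * cabs (malpha F)).
Proof.
move=> z1; rewrite mobius_funB ?cabs0// subr0 mobius_den0.
by rewrite !(cabsM, cabsV, cabs_conj).
Qed.

(** This identity makes preimages small. By [mobius_funB], each chord
    between values of F is the chord between the arguments divided by
    the two denominators; for an argument at the origin the denominator has
    modulus |alpha| and 1 / |alpha|^2 = 1 - |F(0)|^2, so the denominators at z
    and y cancel. *)
Lemma mobius_chord F z y : cabs z = 1 -> cabs y = 1 ->
  cabs (z - y) * (cabs (mobius_fun F z - mobius_fun F 0) *
                  cabs (mobius_fun F y - mobius_fun F 0)) =
  (1 - cabs (mobius_fun F 0) ^+ 2) * cabs (mobius_fun F z - mobius_fun F y).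
Proof.
move=> z1 y1; rewrite !cabs_mobius_funB0 ?z1 ?y1// mobius_funB ?z1 ?y1//.
rewrite onem_sqr_mobius_fun0 !(cabsM, cabsV) !div1r !invfM; ring.
Qed.

Lemma mobius_den_ge F z : cabs (malpha F) * (1 - cabs z) <= cabs (mobius_den F z).
Proof.
have -> : mobius_den F z = (malpha F)^* - - ((mbeta F)^* * z).
  by rewrite opprK addrC.
apply: le_trans (cabs_dist_ge _ _); rewrite cabsN cabsM !cabs_conj mulrBr mulr1.
by rewrite lerD2l lerN2 ler_wpM2r ?cabs_ge0// ltW// mbeta_lt_malpha.
Qed.

Lemma mobius_den_le F z : cabs z <= 1 -> cabs (mobius_den F z) <= 2 * cabs (malpha F).
Proof.
move=> z1; apply: le_trans (cabsD _ _) _; rewrite cabsM !cabs_conj.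
rewrite mulr_natl mulr2n lerD2r (le_trans (ler_piMr _ z1))// ?cabs_ge0//.
by rewrite ltW// mbeta_lt_malpha.
Qed.

(** The hyperbolic distance from F(z) to F(0) is that from z to 0, so the
    Euclidean distance is at most of the order of 1 - |F(0)|^2. *)
Lemma mobius_funB0_le F z : cabs z < 1 ->
  cabs (mobius_fun F z - mobius_fun F 0) <=
  (1 - cabs (mobius_fun F 0) ^+ 2) / (1 - cabs z).
Proof.
move=> z1; rewrite cabs_mobius_funB0 ?(ltW z1)// onem_sqr_mobius_fun0.
have z10 : 0 < 1 - cabs z by rewrite subr_gt0.
have a0 := malpha_gt0 F.
have dg := mobius_den_ge F z.
have d0 : 0 < cabs (mobius_den F z) by apply: lt_le_trans dg; rewrite mulr_gt0.
rewrite -invfM; apply: (@le_trans _ _ (cabs (mobius_den F z) * cabs (malpha F))^-1).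
  by rewrite ler_piMl ?invr_ge0 ?mulr_ge0 ?cabs_ge0// ltW.
rewrite lef_pV2 ?posrE ?mulr_gt0 ?exprn_gt0//.
by rewrite expr2 -mulrA [leLHS]mulrC ler_wpM2r ?cabs_ge0.
Qed.

(** The conformal factor 1 - |z|^2 is multiplied by |F'(z)|. *)
Lemma onem_sqr_mobius_fun F z : cabs z <= 1 ->
  1 - cabs (mobius_fun F z) ^+ 2 = (1 - cabs z ^+ 2) / cabs (mobius_den F z) ^+ 2.
Proof.
move=> z1.
have dz : cabs (mobius_den F z) ^+ 2 != 0.
  by rewrite sqrf_eq0 cabs_eq0 mobius_den_neq0// cabsE lecR.
apply: (mulIf dz); rewrite divfK// mulrBl mul1r -exprMn -cabsM /mobius_fun divfK; last first.
  by rewrite mobius_den_neq0// cabsE lecR.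
apply: complexI; rewrite rmorphB /= rmorphB /= rmorph1 !sqr_cabsE /mobius_den.
rewrite !(rmorphD, rmorphM) /= !conjCK.
rewrite -[RHS]mulr1 -[X in _ = _ * X](mobius_detE F); ring.
Qed.

(** For |z| < 1, the value at the origin cannot stay inside the disc when the
    value at z approaches the circle: the conformal factors at F(0) and F(z)
    are comparable because the denominators at 0 and z are. *)
Lemma onem_sqr_mobius_fun_ge F z : cabs z <= 1 ->
  (1 - cabs z ^+ 2) * (1 - cabs (mobius_fun F 0) ^+ 2) <=
  4 * (1 - cabs (mobius_fun F z) ^+ 2).
Proof.
move=> z1; rewrite (onem_sqr_mobius_fun F z1) onem_sqr_mobius_fun0 mulrCA.
have dz : 0 < cabs (mobius_den F z).
  by rewrite cabs_gt0 mobius_den_neq0// cabsE lecR.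
apply: ler_wpM2l; first by rewrite subr_ge0 expr_le1// cabs_ge0.
rewrite -[4]invrK -invfM lef_pV2 ?posrE ?mulr_gt0 ?exprn_gt0 ?invr_gt0 ?malpha_gt0//.
have -> : 4^-1 = (2^-1) ^+ 2 :> R by field.
rewrite -exprMn ler_pXn2r// ?nnegrE ?mulr_ge0 ?cabs_ge0//.
by rewrite ler_pdivrMl// mobius_den_le.
Qed.

Lemma onem_sqr_le_dist (x y : C R) : cabs x = 1 -> cabs y <= 1 ->
  1 - cabs y ^+ 2 <= 2 * cabs (y - x).
Proof.
move=> x1 y1; have := cabs_dist_ge x y; rewrite x1 cabsBC => h.
have -> : 1 - cabs y ^+ 2 = (1 + cabs y) * (1 - cabs y) by ring.
apply: ler_pM; rewrite ?subr_ge0 ?addr_ge0 ?cabs_ge0//; lra.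
Qed.

(** * Expansion sets of the inverse *)

Lemma mobius_den_invE F z :
  mobius_den (mobius_inv F) z = malpha F - (mbeta F)^* * z.
Proof. by rewrite /mobius_den /= rmorphN /= conjCK mulNr addrC. Qed.

Lemma mobius_dot_ge1 F z :
  (1 <= mobius_dot F (Some z))%E = (cabs (mobius_den F z) <= 1).
Proof.
rewrite /=; case: eqP => [->|/eqP d0]; first by rewrite cabs0 ler01 leey.
rewrite lee_fin invf_ge1 ?exprn_gt0 ?cabs_gt0//.
by rewrite expr_le1// cabs_ge0.
Qed.

Lemma mobius_dot_gt1 F z :
  (1 < mobius_dot F (Some z))%E = (cabs (mobius_den F z) < 1).
Proof.
rewrite /=; case: eqP => [->|/eqP d0]; first by rewrite cabs0 ltr01 ltry.
rewrite lte_fin invf_gt1 ?exprn_gt0 ?cabs_gt0//.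
by rewrite expr_lt1// cabs_ge0.
Qed.

Lemma expansion_set_invE F : mbeta F != 0 ->
  expansion_set (mobius_inv F) =
  Some @` closed_disc_at (malpha F / (mbeta F)^*) (cabs (mbeta F))^-1.
Proof.
move=> b0; have cb0 : (mbeta F)^* != 0 by rewrite conjC_eq0.
have B0 : 0 < cabs (mbeta F) by rewrite cabs_gt0.
have key z : (cabs (mobius_den (mobius_inv F) z) <= 1) =
    (cdist z (malpha F / (mbeta F)^*) <= (cabs (mbeta F))^-1).
  rewrite mobius_den_invE /cdist cabsBC.
  have -> : malpha F - (mbeta F)^* * z = (mbeta F)^* * (malpha F / (mbeta F)^* - z).
    by field.
  by rewrite cabsM cabs_conj -[X in _ = (_ <= X)]mulr1 ler_pdivlMl.
apply/seteqP; split => [[z|]|_ [z hz <-]]; rewrite /expansion_set /mkset.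
- by rewrite mobius_dot_ge1 key => hz; exists z.
- by rewrite /= oppr_eq0 (negbTE b0) leNgt lte_fin ltr01.
- by rewrite mobius_dot_ge1 key.
Qed.

Lemma cabs_direction z : exists2 u : C R, cabs u = 1 & z = (cabs z)%:C%C * u.
Proof.
have [->|z0] := eqVneq z 0; first by exists 1; rewrite ?cabs1// cabs0 mul0r.
have cz0 : (cabs z)%:C%C != 0 :> C R by rewrite -cabsE normr_eq0.
exists (z / (cabs z)%:C%C); last by rewrite mulrC divfK.
by rewrite cabsM cabsV cabsR ger0_norm ?cabs_ge0// divff// cabs_eq0.
Qed.

(** The point of the smaller disc farthest from the center c' is
    c + r u, with u the direction of c - c'. *)
Lemma closed_disc_at_sub (c c' : C R) (r r' : R) : 0 <= r ->
  closed_disc_at c r `<=` closed_disc_at c' r' -> cabs (c - c') + r <= r'.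
Proof.
move=> r0 cc'; have [u u1 cu] := cabs_direction (c - c').
have : closed_disc_at c' r' (c + r%:C%C * u).
  apply: cc'; rewrite /closed_disc_at /= /cdist addrAC subrr add0r.
  by rewrite cabsM u1 mulr1 cabsR ger0_norm.
rewrite /closed_disc_at /= /cdist addrAC {1}cu -mulrDl -rmorphD cabsM u1 mulr1 /=.
by rewrite cabsR ger0_norm// addr_ge0// cabs_ge0.
Qed.

Lemma closed_disc_at_inj (c c' : C R) (r r' : R) : 0 <= r -> 0 <= r' ->
  closed_disc_at c r = closed_disc_at c' r' -> c = c'.
Proof.
move=> r0 r'0 E.
have h1 : cabs (c - c') + r <= r' by apply: closed_disc_at_sub => //; rewrite E.
have h2 : cabs (c - c') + r' <= r.
  by rewrite cabsBC; apply: closed_disc_at_sub => //; rewrite E.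
apply/eqP; rewrite -subr_eq0 -cabs_eq0 eq_le cabs_ge0 andbT; lra.
Qed.

Lemma finite_part_Some (A : set (C R)) : finite_part (Some @` A) = A.
Proof. by apply/seteqP; split => [z [y Ay [<-]]|z Az]//; exists z. Qed.

Lemma disc_center_expansion_set F : mbeta F != 0 ->
  disc_center (expansion_set (mobius_inv F)) = malpha F / (mbeta F)^*.
Proof.
move=> b0; have B0 : 0 < (cabs (mbeta F))^-1 by rewrite invr_gt0 cabs_gt0.
rewrite /disc_center expansion_set_invE//; apply: xget_unique.
  by exists (cabs (mbeta F))^-1.
move=> c [r r0] /(congr1 (@finite_part R)).
by rewrite !finite_part_Some => /closed_disc_at_inj ->//; exact: ltW.
Qed.

Lemma finite_part_expansion_set F : mbeta F != 0 ->
  finite_part (expansion_set (mobius_inv F)) =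
  closed_disc_at (malpha F / (mbeta F)^*) (cabs (mbeta F))^-1.
Proof.
by move=> b0; rewrite expansion_set_invE// finite_part_Some.
Qed.

Lemma expansion_interval_invP F (z : circle R) :
  expansion_interval (mobius_inv F) z <->
  cabs (malpha F - (mbeta F)^* * \val z) < 1.
Proof. by rewrite /expansion_interval /mkset mobius_dot_gt1 mobius_den_invE. Qed.

Lemma expansion_interval_sub F (z : circle R) :
  expansion_interval (mobius_inv F) z ->
  finite_part (expansion_set (mobius_inv F)) (\val z).
Proof. by move=> /ltW. Qed.

(** The expansion interval is an arc centered at k, the direction of F(0), with
    half-angle arccos |F(0)|. *)
Lemma expansion_interval_direction F : mbeta F != 0 ->
  exists k : C R, [/\ cabs k = 1,
    cabs (mobius_fun F 0 - k) = 1 - cabs (mobius_fun F 0) &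
    forall u : C R, cabs u = 1 -> cabs (mobius_fun F 0) < complex.Re u ->
      exists2 z, expansion_interval (mobius_inv F) z & \val z = k * u].
Proof.
move=> b0; have B0 : 0 < cabs (mbeta F) by rewrite cabs_gt0.
have A0 := malpha_gt0 F.
set w := mobius_fun F 0.
have w0 : cabs w != 0.
  by rewrite /w cabs_mobius_fun0 mulf_neq0 ?invr_neq0// gt_eqF.
have [k k1 wk] := cabs_direction w.
exists k; split => //.
  rewrite {1}wk -{2}(mul1r k) -mulrBl -(rmorph1 (real_complex R)) -rmorphB.
  rewrite cabsM k1 mulr1 cabsR distrC ger0_norm//.
  by rewrite subr_ge0 ltW// mobius_fun0_lt1.
move=> u u1 hu.
have z1 : unit_circle (k * u) by apply/unit_circleP; rewrite cabsM k1 u1 mulr1.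
exists (SigSub (mem_set z1)) => //; apply/expansion_interval_invP => /=.
have A0' : malpha F != 0 by rewrite -cabs_gt0.
(* hence alpha - conj(beta) k u = alpha (1 - |w| u), and the condition is
   |1 - |w| u|^2 < 1 / |alpha|^2 = 1 - |w|^2 *)
have bE : (mbeta F)^* * k = malpha F * (cabs w)%:C%C.
  have -> : mbeta F = (malpha F)^* * ((cabs w)%:C%C * k).
    by rewrite -wk /w mobius_fun0 mulrC divfK// conjC_eq0.
  rewrite !rmorphM /= conjCK -!mulrA; congr (_ * _).
  rewrite [_ * k]mulrC -normCK cabsE k1 /= expr1n mulr1.
  by rewrite -cabsE geC0_conj.
rewrite mulrA bE -mulrA -{1}(mulr1 (malpha F)) -mulrBr cabsM.
rewrite -(@expr_lt1 _ 2)// ?mulr_ge0 ?cabs_ge0// exprMn.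
have A20 : 0 < cabs (malpha F) ^+ 2 by rewrite exprn_gt0.
rewrite -ltr_pdivlMl// mulr1 -onem_sqr_mobius_fun0 -/w.
have -> : cabs (1 - (cabs w)%:C%C * u) ^+ 2 =
    1 + cabs w ^+ 2 * cabs u ^+ 2 - (cabs w * complex.Re u) *+ 2.
  by rewrite (sqr_cabs u) (sqr_cabs (1 - _)); case: u {u1 hu z1} => a b /=; ring.
rewrite u1 expr1n mulr1.
have : cabs w * cabs w < cabs w * complex.Re u.
  by rewrite ltr_pM2l// lt0r w0 cabs_ge0.
rewrite expr2; lra.
Qed.

End moebius.

(** * Images of the uniform measure *)

Section implications.
Context {R : realType}.
Implicit Types (F : nat -> mobius R) (x : circle R).
Local Notation mu := (@circle_measure R).

(** The condition through which all the others are compared. *)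
Definition center_cvg F x :=
  mobius_fun (F n) 0 @[n --> \oo] --> (\val x : C R).

(** A set of small diameter lies in a short arc around any of its points. *)
Lemma circle_measure_small_diam (c : R) : 0 < c ->
  exists2 h : R, 0 < h & forall A : set (circle R), open A ->
    (forall z y, A z -> A y -> cabs (\val z - \val y) < h) ->
    (mu A <= c%:E)%E.
Proof.
move=> c0; have [e /andP[e0 epi] ec] := @circle_measure_arc_small R c c0.
have [h h0 he] := @arc_small_of_chord_small R e e0.
exists h => // A oA Ah; have [->|/set0P[y Ay]] := eqVneq A set0.
  by rewrite measure0 lee_fin ltW.
apply: le_trans (ec y); apply: le_measure; rewrite ?inE.
- exact: measurable_open_circle.
- by apply: measurable_open_circle; exact: open_arc_dist_lt.
- by move=> z Az; apply: he; exact: Ah.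
Qed.

Lemma open_mobius_preimage (G : mobius R) (I : set (circle R)) :
  open I -> open (mobius_circle G @^-1` I).
Proof. by move/continuousP : (@continuous_mobius_circle R G); exact. Qed.

Lemma measurable_mobius_preimage (G : mobius R) (I : set (circle R)) : open I ->
  measurable (mobius_circle G @^-1` I : set (borel_circle R)).
Proof.
by move=> oI; apply: measurable_open_circle; exact: open_mobius_preimage.
Qed.

Lemma mobius_push_le1 (G : mobius R) (I : set (circle R)) : open I ->
  (mobius_push G mu I <= 1)%E.
Proof.
move=> oI; apply: probability_le1; exact: measurable_mobius_preimage.
Qed.

Lemma measurable_mobius_comp (G : mobius R) (f : circle R -> R) : continuous f ->
  measurable_fun [set: borel_circle R] (fun z => f (mobius_circle G z)).
Proof.
move=> cf; apply: (measurableT_comp (measurable_continuous_circle cf)).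
exact: measurable_mobius_circle.
Qed.

Lemma integrable_mobius_comp (G : mobius R) (f : circle R -> R) : continuous f ->
  mu.-integrable setT (fun z : borel_circle R => (f (mobius_circle G z))%:E).
Proof.
move=> cf; have [M M0 fM] := continuous_circle_bounded cf.
apply: (@le_integrable _ _ _ _ _ _ _ (cst M%:E)) => //.
- by apply/measurable_EFinP; exact: measurable_mobius_comp.
- by move=> z _ /=; rewrite lee_fin (le_trans (fM _))// ler_norm.
- exact: finite_measure_integrable_cst.
Qed.

Lemma integral_mobius_push (G : mobius R) (f : circle R -> R) : continuous f ->
  (\int[mobius_push G mu]_z (f z)%:E = \int[mu]_z (f (mobius_circle G z))%:E)%E.
Proof.
move=> cf.
apply: (@integral_pushforward _ _ _ _ _ _ (measurable_mobius_circle G) mu setT (EFin \o f)) => //.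
  by apply/measurable_EFinP; exact: measurable_continuous_circle.
by rewrite preimage_setT; exact: integrable_mobius_comp.
Qed.

(** A continuous bump function f with f(x) = 1 and f <= 1_I gives
    [\int f d(F_n mu) <= F_n mu(I) <= 1]. *)
Lemma represents_open_interval F x : represents F x ->
  forall I : set (circle R), open_interval I -> I x ->
    mobius_push (F n) mu I @[n --> \oo] --> 1%E.
Proof.
move=> Fx I oI Ix; have [e e0 eI] := open_interval_arc oI Ix.
have ce1 := cos_lt1 e0; have e0' : 0 <= e <= pi by case/andP: e0 => /ltW -> ->.
have oI' := open_interval_open oI.
(* affine in circle_cos, positive exactly on the arc of radius e around x *)
pose f (z : circle R) := Num.max 0 ((circle_cos z x - cos e) / (1 - cos e)).
have cf : continuous f.
  move=> z; apply: (@continuous_comp _ _ _ (fun z => circle_cos z x)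
    (fun t => Num.max 0 ((t - cos e) / (1 - cos e)))).
    exact: continuous_circle_cos.
  apply: (@continuous_max R R (cst 0) (fun t => (t - cos e) / (1 - cos e))).
    exact: cvg_cst.
  by apply: cvgM; [apply: cvgB; [exact: cvg_id|exact: cvg_cst]|exact: cvg_cst].
have f1 z : f z <= 1.
  rewrite /f ge_max ler01/= ler_pdivrMr ?subr_gt0// mul1r lerB//.
  by have /andP[] := circle_cos_bounds z x.
have fI z : ~ I z -> f z = 0.
  move=> nIz; apply/max_idPl; rewrite ler_pdivrMr ?subr_gt0// mul0r subr_le0 leNgt.
  by apply/negP => h; apply: nIz; apply: eI; rewrite /mkset arc_dist_lt.
have fx : f x = 1.
  rewrite /f -(cos_arc_dist x x) arc_dist_refl cos0 divff ?gt_eqF ?subr_gt0//.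
  by apply/max_idPr.
have := Fx f cf; rewrite integral_dirac//; last first.
  by apply/measurable_EFinP; exact: measurable_continuous_circle.
rewrite diracT mul1e fx => h.
apply: (squeeze_cvge _ h (cvg_cst 1%E)); apply: nearW => n.
rewrite mobius_push_le1// andbT integral_mobius_push//.
have mFI := measurable_mobius_preimage (F n) oI'.
have -> : mobius_push (F n) mu I =
    (\int[mu]_z (\1_(mobius_circle (F n) @^-1` I) z)%:E)%E.
  by rewrite integral_indic// setIT.
apply: ge0_le_integral => //.
- by move=> z _; rewrite lee_fin le_max lexx.
- apply/measurable_EFinP.
  exact: measurable_mobius_comp.
- apply/measurable_EFinP.
  exact: (@measurable_indic _ (borel_circle R) _ _ _ mFI).
- move=> z _; rewrite lee_fin indicE; have [Iz|nIz] := pselect (I (mobius_circle (F n) z)).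
    by rewrite mem_set//= f1.
  by rewrite memNset//= fI.
Qed.

Lemma open_interval_limn_einf F x :
  (forall I : set (circle R), open_interval I -> I x ->
    mobius_push (F n) mu I @[n --> \oo] --> 1%E) ->
  exists2 c : R, 0 < c &
    forall I : set (circle R), open_interval I -> I x ->
      (c%:E < limn_einf (fun n => mobius_push (F n) mu I))%E.
Proof.
move=> FI; exists (2^-1); first by rewrite invr_gt0.
move=> I oI Ix; rewrite (cvg_limn_einf_sup (FI I oI Ix)) lte_fin.
by rewrite invf_lt1// ltr1n.
Qed.

(** If |w - x| >= e, then the points near x are at distance at least e / 2 from
    w, so F^-1 expands chords near x by at most (2 / e)^2 ([mobius_chord]) and
    the preimage of a short interval has measure at most c, whatever its
    position on the circle. *)
Lemma limn_einf_center_cvg F x :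
  (exists2 c : R, 0 < c &
    forall I : set (circle R), open_interval I -> I x ->
      (c%:E < limn_einf (fun n => mobius_push (F n) mu I))%E) ->
  center_cvg F x.
Proof.
move=> [c c0 FI]; apply/cvg_cabsP => e e0.
have [h h0 hc] := circle_measure_small_diam c0.
have h20 : 0 < Num.min (e / 2) (h * (e / 2) ^+ 2 / 2).
  by rewrite lt_min !(mulr_gt0, exprn_gt0, invr_gt0).
have [r r0 rh] := chord_small_of_arc_small h20.
have oI := arc_open_interval x r0.
have Ix : [set z | arc_dist z x < r] x.
  by rewrite /mkset arc_dist_refl; case/andP : r0.
apply: filterS (limn_einf_gt (FI _ oI Ix)) => n cn.
rewrite ltNge; apply/negP => ew; move: cn; apply/negP; rewrite -leNgt.
apply: hc.
  by apply: open_mobius_preimage; exact: open_interval_open.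
move=> z y /rh/= + /rh/=; rewrite !lt_min => /andP[zx1 zx2] /andP[yx1 yx2].
set w := mobius_fun (F n) 0 in ew *.
have far a : cabs (a - \val x) < e / 2 -> e / 2 <= cabs (a - w).
  move=> ax; have := cabs_triangle a w (\val x); rewrite (cabsBC w a); lra.
have K := mobius_chord (F n) (cabs_circle z) (cabs_circle y).
have Fzy : cabs (mobius_fun (F n) (\val z) - mobius_fun (F n) (\val y)) <
    h * (e / 2) ^+ 2.
  have := cabs_triangle (\val x) (mobius_fun (F n) (\val z)) (mobius_fun (F n) (\val y)).
  rewrite (cabsBC (\val x)); lra.
have ee : (e / 2) ^+ 2 <= cabs (mobius_fun (F n) (\val z) - w) *
   cabs (mobius_fun (F n) (\val y) - w).
  by rewrite expr2 ler_pM ?far// divr_ge0// ltW.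
have e20 : 0 < (e / 2) ^+ 2 by rewrite exprn_gt0// divr_gt0.
rewrite -(ltr_pM2r e20); apply: le_lt_trans Fzy.
apply: (@le_trans _ _ (cabs (\val z - \val y) * (cabs (mobius_fun (F n) (\val z) - w) *
   cabs (mobius_fun (F n) (\val y) - w)))).
  by rewrite ler_wpM2l// cabs_ge0.
by rewrite K ler_piMl ?cabs_ge0// gerBl sqr_ge0.
Qed.

(** The points mapped away from x are mapped away from w as well; by
    [mobius_chord] their mutual distances are O(1 - |w|^2). *)
Lemma center_cvg_in_measure F x : center_cvg F x ->
  forall e : R, 0 < e ->
    mu [set z : borel_circle R |
        e < arc_dist (mobius_circle (F n) z) x] @[n --> \oo] --> 0%E.
Proof.
move=> /cvg_cabsP Fx e e0; apply/cvge_finP => c c0.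
have [h h0 hc] := circle_measure_small_diam c0.
have [k k0 ke] := @arc_small_of_chord_small R e e0.
(* (1 - |w|^2) |F z - F y| <= 2 |w - x| * 2, to be compared with h (k / 2)^2 *)
have d0 : 0 < Num.min (k / 2) (h * (k / 2) ^+ 2 / 4).
  by rewrite lt_min !(mulr_gt0, exprn_gt0, invr_gt0).
apply: filterS (Fx _ d0) => n; set w := mobius_fun (F n) 0.
rewrite lt_min => /andP[wx1 wx2].
rewrite sub0r add0r; apply/andP; split.
  by apply: le_trans (measure_ge0 _ _); rewrite lee_fin oppr_le0 ltW.
apply: hc.
  exact: (open_mobius_preimage (F n) (open_arc_dist_gt x e)).
have far z : e < arc_dist (mobius_circle (F n) z) x ->
    k / 2 <= cabs (mobius_fun (F n) (\val z) - w).
  move=> ez; rewrite leNgt; apply/negP => zw; move: ez; apply/negP.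
  rewrite -leNgt; apply/ltW/ke => /=.
  have := cabs_triangle w (mobius_fun (F n) (\val z)) (\val x); lra.
move=> z y /far zw /far yw.
have K := mobius_chord (F n) (cabs_circle z) (cabs_circle y).
have k20 : 0 < (k / 2) ^+ 2 by rewrite exprn_gt0// divr_gt0.
have ee : (k / 2) ^+ 2 <= cabs (mobius_fun (F n) (\val z) - w) *
   cabs (mobius_fun (F n) (\val y) - w).
  by rewrite expr2 ler_pM// divr_ge0// ltW.
rewrite -(ltr_pM2r k20); apply: (@le_lt_trans _ _ ((1 - cabs w ^+ 2) * 2)).
  apply: (@le_trans _ _ (cabs (\val z - \val y) * (cabs (mobius_fun (F n) (\val z) - w) *
     cabs (mobius_fun (F n) (\val y) - w)))).
    by rewrite ler_wpM2l// cabs_ge0.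
  rewrite K; apply: ler_wpM2l.
    by rewrite subr_ge0 expr_le1// ?cabs_ge0// ltW// mobius_fun0_lt1.
  have := cabs_triangle 0 (mobius_fun (F n) (\val z)) (mobius_fun (F n) (\val y)).
  rewrite subr0 sub0r cabsN.
  by rewrite !(cabs_circle (mobius_circle (F n) _)).
have := onem_sqr_le_dist (cabs_circle x) (ltW (mobius_fun0_lt1 (F n))).
rewrite -/w; lra.
Qed.

(** |f o F_n - f(x)| is small off the set B of points mapped away from x, and
    bounded by 2M on B, where M bounds |f|. *)
Lemma cvg_in_measure_represents F x :
  (forall e : R, 0 < e ->
    mu [set z : borel_circle R |
        e < arc_dist (mobius_circle (F n) z) x] @[n --> \oo] --> 0%E) ->
  represents F x.
Proof.
move=> Fx f cf; rewrite integral_dirac//; last first.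
  by apply/measurable_EFinP; exact: measurable_continuous_circle.
rewrite diracT mul1e; apply/cvge_finP => e e0.
have [M M0 fM] := continuous_circle_bounded cf.
have e20 : 0 < e / 2 by rewrite divr_gt0.
have [r /andP[r0 rpi] rf] : exists2 r : R, 0 < r <= pi &
    [set z | arc_dist z x < r] `<=` [set z | `|f x - f z| < e / 2].
  apply/nbhs_circleP.
  by have /(@cvgrPdist_lt _ _ _ (nbhs x) (nbhs_filter x)) := cf x; exact.
have r20 : 0 < r / 2 by rewrite divr_gt0.
(* the summand 1 only covers the case M = 0 *)
have m0 : 0 < e / 2 / (2 * M + 1) by rewrite divr_gt0// ltr_wpDl// mulr_ge0.
move: (Fx _ r20) => /cvge_finP/(_ _ m0); apply: filterS => n.
set B := mkset _; rewrite sub0r add0r => /andP[_ muB].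
have mB : measurable B.
  exact: (measurable_mobius_preimage (F n) (open_arc_dist_gt x (r / 2))).
have mfF : measurable_fun setT (fun z : borel_circle R => f (mobius_circle (F n) z)).
  exact: measurable_mobius_comp.
rewrite integral_mobius_push//.
have Bf z : `|f (mobius_circle (F n) z) - f x| <= e / 2 + 2 * M * \1_B z.
  rewrite indicE; have [Bz|nBz] := pselect (B z).
    rewrite mem_set//= mulr1 (le_trans (ler_normB _ _))//.
    by have := fM x; have := fM (mobius_circle (F n) z); lra.
  rewrite memNset//= mulr0 addr0 distrC ltW//; apply: rf; rewrite /mkset.
  apply: (@le_lt_trans _ _ (r / 2)); last by rewrite ltr_pdivrMr// ltr_pMr// ltr1n.
  by rewrite leNgt; apply/negP.
have mM1 : measurable_fun setT (fun z : borel_circle R => 2 * M * \1_B z : R).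
  by apply: measurable_funM => //; exact: (@measurable_indic _ (borel_circle R) _ _ _ mB).
have int : (\int[mu]_z (`|f (mobius_circle (F n) z) - f x|)%:E <= e%:E)%E.
  apply: (@le_trans _ _ (\int[mu]_z (e / 2 + 2 * M * \1_B z)%:E)%E).
    apply: ge0_le_integral => //.
    - apply/measurable_EFinP; apply: measurableT_comp => //.
      exact: measurable_funB.
    - by apply/measurable_EFinP; exact: measurable_funD.
    - by move=> z _; rewrite lee_fin.
  under eq_integral do rewrite EFinD.
  rewrite ge0_integralD//; last 3 first.
  - by move=> z _; rewrite lee_fin ltW.
  - by move=> z _; rewrite lee_fin mulr_ge0// mulr_ge0.
  - exact/measurable_EFinP.
  under [X in (_ + X)%E]eq_integral do rewrite EFinM.
  rewrite integral_cst// [X in (_ * X + _)%E](_ : _ = 1%E); last exact: probability_setT.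
  rewrite mule1 ge0_integralZl//; last 2 first.
  - by apply/measurable_EFinP; exact: (@measurable_indic _ (borel_circle R) _ _ _ mB).
  - by rewrite lee_fin mulr_ge0.
  rewrite integral_indic// setIT.
  apply: (@le_trans _ _ ((e / 2)%:E + (2 * M)%:E * (e / 2 / (2 * M + 1))%:E)%E).
    apply: leeD => //; apply: lee_wpmul2l; last exact: muB.
    by rewrite lee_fin mulr_ge0.
  rewrite -EFinM -EFinD lee_fin.
  have : 2 * M * (e / 2 / (2 * M + 1)) <= e / 2.
    rewrite mulrA ler_pdivrMr; first by rewrite mulrC; apply: ler_wpM2l; [exact: ltW|lra].
    by rewrite ltr_wpDl// mulr_ge0.
  lra.
have ifF := integrable_mobius_comp (F n) cf.
have icst : mu.-integrable setT (fun=> (f x)%:E).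
  exact: finite_measure_integrable_cst.
have : (`|\int[mu]_z (f (mobius_circle (F n) z) - f x)%:E| <= e%:E)%E.
  apply: le_trans int; apply: le_abse_integral => //.
  by apply/measurable_EFinP; exact: measurable_funB.
under eq_integral do rewrite EFinB.
rewrite integralB// integral_cst// [X in (_ * X)%E](_ : _ = 1%E); last exact: probability_setT.
rewrite mule1.
have fI : (\int[mu]_z (f (mobius_circle (F n) z))%:E)%E \is a fin_num.
  exact: integrable_fin_num.
by rewrite -(fineK fI) -EFinB /= !lee_fin ler_distl => ->.
Qed.

End implications.

(** * Origins, expansion sets and orbits *)

Section geometry.
Context {R : realType}.
Implicit Types (F : nat -> mobius R) (x : circle R).

Lemma near_not_rotation F : finite_set [set n | mobius_rotation (F n)] ->
  \forall n \near \oo, mbeta (F n) != 0.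
Proof. by move=> /near_not_finite; apply: filterS => n /eqP. Qed.

Lemma cdist_ge0 (y z : C R) : 0 <= cdist y z.
Proof. exact: cabs_ge0. Qed.

(** As d = 1 / conj(w) and |x| = 1, one has |d - x| |w| = |w - x|. *)
Lemma center_disc_center_cvg F x :
  finite_set [set n | mobius_rotation (F n)] -> center_cvg F x ->
  disc_center (expansion_set (mobius_inv (F n))) @[n --> \oo] --> (\val x : C R).
Proof.
move=> fr /cvg_cabsP Fx; apply/cvg_cabsP => e e0.
have d0 : 0 < Num.min (2^-1) (e / 2) by rewrite lt_min invr_gt0 divr_gt0// ltr0n.
apply: filterS2 (near_not_rotation fr) (Fx _ d0) => n b0.
rewrite lt_min disc_center_expansion_set// mobius_fun0 => /andP[].
move: (malpha (F n)) (mbeta (F n)) b0 (malpha_gt0 (F n)) => a b b0 a0 h1 h2.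
have a0' : a != 0 by rewrite -cabs_gt0.
have xx := circle_mul_conj x.
have x1 := cabs_circle x.
set w := b / a^* in h1 h2 *.
have wg : 2^-1 < cabs w.
  by have := cabs_dist_ge (\val x) w; rewrite x1 cabsBC; lra.
have b0' : b^* != 0 by rewrite conjC_eq0.
have key : (a / b^* - \val x) * w^* = (\val x - w)^* * \val x.
  rewrite /w rmorphM rmorphB fmorphV /= rmorphM fmorphV /= conjCK mulrBl mulrBl.
  rewrite [_^* * \val x]mulrC xx [\val x * _]mulrC; congr (_ - _).
  by field; rewrite a0'.
have := congr1 cabs key; rewrite !cabsM !cabs_conj x1 mulr1 (cabsBC (\val x)) => key'.
have : cabs (a / b^* - \val x) / 2 <= cabs (a / b^* - \val x) * cabs w.
  by rewrite ler_wpM2l ?cabs_ge0// ltW.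
rewrite key'; lra.
Qed.

(** The squared radius |d|^2 - 1 is at most 3 |d - x| when |d - x| <= 1. *)
Lemma disc_center_expansion_set_cvg F x :
  finite_set [set n | mobius_rotation (F n)] ->
  disc_center (expansion_set (mobius_inv (F n))) @[n --> \oo] --> (\val x : C R) ->
  hausdorff_cvg cdist (fun n => finite_part (expansion_set (mobius_inv (F n))))
    [set \val x].
Proof.
move=> fr /cvg_cabsP dx; apply/hausdorff_cvg1P.
- exact: cdist_ge0.
- apply: filterS (near_not_rotation fr) => n b0; rewrite finite_part_expansion_set//.
  exists (malpha (F n) / (mbeta (F n))^*).
  by rewrite /closed_disc_at/= /cdist subrr cabs0 invr_ge0 cabs_ge0.
move=> e e0.
have d0 : 0 < Num.min (Num.min 1 (e / 2)) (e ^+ 2 / 12).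
  by rewrite !lt_min ltr01 !divr_gt0// exprn_gt0.
apply: filterS2 (near_not_rotation fr) (dx _ d0) => n b0.
rewrite finite_part_expansion_set// disc_center_expansion_set//.
set d := malpha _ / _; rewrite !lt_min => /andP[/andP[d1 de] dee] z.
rewrite /closed_disc_at/= /cdist => zd.
have B0 : 0 < cabs (mbeta (F n)) by rewrite cabs_gt0.
have dE : cabs d ^+ 2 = 1 + ((cabs (mbeta (F n)))^-1) ^+ 2.
  rewrite /d cabsM cabsV cabs_conj exprMn sqr_malpha mulrDl mul1r -exprMn.
  by rewrite divff ?gt_eqF// expr1n addrC.
have dx1 : cabs d <= 1 + cabs (d - \val x).
  by have := cabs_dist_ge d (\val x); rewrite cabs_circle; lra.
have : (cabs (mbeta (F n)))^-1 < e / 2.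
  rewrite -(@ltr_pXn2r _ 2)// ?nnegrE ?invr_ge0 ?cabs_ge0 ?divr_ge0 ?(ltW e0)//.
  have -> : (e / 2) ^+ 2 = e ^+ 2 / 4 by field.
  have : cabs d ^+ 2 <= (1 + cabs (d - \val x)) ^+ 2.
    by rewrite ler_pXn2r// ?nnegrE ?addr_ge0 ?cabs_ge0.
  have : cabs (d - \val x) ^+ 2 <= cabs (d - \val x).
    by rewrite expr2 ler_piMl ?cabs_ge0// ltW.
  rewrite dE sqrrD expr1n mul1r; lra.
have := cabs_triangle d z (\val x); lra.
Qed.

Lemma expansion_interval_nonempty (G : mobius R) : mbeta G != 0 ->
  expansion_interval (mobius_inv G) !=set0.
Proof.
move=> b0; have [k [_ _ /(_ 1 (@cabs1 R))]] := expansion_interval_direction b0.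
by rewrite /= => /(_ (mobius_fun0_lt1 G))[z Vz _]; exists z.
Qed.

(** The expansion interval is contained in the expansion set, and passing to its
    closure costs only a strict inequality. *)
Lemma expansion_set_expansion_interval_cvg F x :
  finite_set [set n | mobius_rotation (F n)] ->
  hausdorff_cvg cdist (fun n => finite_part (expansion_set (mobius_inv (F n))))
    [set \val x] ->
  hausdorff_cvg arc_dist
    (fun n => closure (expansion_interval (mobius_inv (F n)))) [set x].
Proof.
move=> fr /hausdorff_cvg1P Dx.
apply/hausdorff_cvg1P.
- exact: arc_dist_ge0.
- apply: filterS (near_not_rotation fr) => n /expansion_interval_nonempty[z Vz].
  by exists z; exact: subset_closure.
move=> e e0; have e20 : 0 < e / 2 by rewrite divr_gt0.
have [h h0 he] := @arc_small_of_chord_small R (e / 2) e20.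
have Dx' : \forall n \near \oo, forall a, finite_part (expansion_set (mobius_inv (F n))) a -> cdist a (\val x) < h.
  apply: Dx => //.
  - exact: cdist_ge0.
  - apply: filterS (near_not_rotation fr) => n /expansion_interval_nonempty[z Vz].
    by exists (\val z); exact: expansion_interval_sub.
apply: filterS Dx' => n Dn z Vz.
suff : arc_dist z x <= e / 2 by move: e0; lra.
have cl : closed [set z | arc_dist z x <= e / 2].
  have -> : [set z | arc_dist z x <= e / 2] = ~` [set z | e / 2 < arc_dist z x].
    by apply/seteqP; split => y /=; rewrite leNgt => /negP.
  by apply: open_closedC; exact: open_arc_dist_gt.
apply: cl; apply: closure_subset Vz => y /expansion_interval_sub/Dn yx.
exact/ltW/he.
Qed.

(** Besides the midpoint k, which shows that the direction of w is near x, the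
    interval contains a point k u at a definite distance from k: with
    Re u = (1 + |w|) / 2 one gets |u - 1|^2 = 1 - |w|. So |w| -> 1 too. *)
Lemma expansion_interval_center_cvg F x :
  finite_set [set n | mobius_rotation (F n)] ->
  hausdorff_cvg arc_dist
    (fun n => closure (expansion_interval (mobius_inv (F n)))) [set x] ->
  center_cvg F x.
Proof.
move=> fr Vx; apply/cvg_cabsP => e e0.
(* |w - x| <= (1 - |w|) + |k - x| < 4 h^2 + h <= 5 h *)
pose h := Num.min 1 (e / 5).
have h0 : 0 < h by rewrite lt_min ltr01 divr_gt0.
have [r /andP[r0 _] rh] := chord_small_of_arc_small h0.
have Vx' : \forall n \near \oo, forall a,
    closure (expansion_interval (mobius_inv (F n))) a -> arc_dist a x < r.
  move/hausdorff_cvg1P : Vx; apply => //; first exact: arc_dist_ge0.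
  apply: filterS (near_not_rotation fr) => n /expansion_interval_nonempty[z Vz].
  by exists z; exact: subset_closure.
apply: filterS2 (near_not_rotation fr) Vx' => n b0 Vn.
have [k [k1 wk kV]] := expansion_interval_direction b0.
set w := mobius_fun (F n) 0 in wk kV *.
have w1 : cabs w < 1 by exact: mobius_fun0_lt1.
have near_k u : cabs u = 1 -> cabs w < complex.Re u -> cabs (k * u - \val x) < h.
  move=> u1 wu; have [z Vz <-] := kV u u1 wu.
  by apply: rh; apply: Vn; exact: subset_closure.
have hk := near_k 1 (@cabs1 R) w1; rewrite mulr1 in hk.
pose c := (1 + cabs w) / 2.
have c0 : 0 <= c by rewrite divr_ge0// addr_ge0// cabs_ge0.
have c1 : c < 1 by rewrite /c; lra.
pose u : C R := (c +i* Num.sqrt (1 - c ^+ 2))%C.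
have c2 : 0 <= 1 - c ^+ 2 by rewrite subr_ge0 expr_le1// ltW.
have u1 : cabs u = 1.
  apply/eqP; rewrite -(@eqrXn2 _ 2)// ?cabs_ge0// expr1n sqr_cabs /= sqr_sqrtr//.
  by rewrite addrC subrK.
have hku : cabs (k * u - \val x) < h by apply: near_k; rewrite //= /c; lra.
have u1E : cabs (u - 1) ^+ 2 = 1 - cabs w.
  by rewrite sqr_cabs /= subr0 sqr_sqrtr// /c; field.
have : cabs (u - 1) < 2 * h.
  have := cabs_triangle (\val x) (k * u) k.
  rewrite -[X in k * u - X](mulr1 k) -mulrBr cabsM k1 mul1r (cabsBC (\val x)); lra.
have h1 : h <= 1 by rewrite ge_min lexx.
have he : h <= e / 5 by rewrite ge_min lexx orbT.
move=> u2h; have : cabs (u - 1) ^+ 2 < (2 * h) ^+ 2.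
  by rewrite ltr_pXn2r// ?nnegrE ?cabs_ge0// mulr_ge0// ltW.
rewrite u1E exprMn => wh.
have h2 : h ^+ 2 <= h by rewrite expr2 ler_piMl// ltW.
have := cabs_triangle k w (\val x); rewrite wk; lra.
Qed.

Lemma continuous_cabs : continuous (@cabs R).
Proof.
move=> z; apply/(@cvgrPdist_lt _ _ _ (nbhs z) (nbhs_filter z)) => e e0.
have := (@cvg_cabsP R _ (nbhs z) (nbhs_filter z) id z).1 (@cvg_id _ _) e e0.
apply: filterS => y yz; rewrite distrC ltr_norml.
have := cabs_dist_ge y z; have := cabs_dist_ge z y; rewrite (cabsBC z); lra.
Qed.

(** The bound of [mobius_funB0_le] is uniform for |z| <= |c|, where c is a point
    of K of maximal modulus. *)
Lemma center_compact_image_cvg F x : center_cvg F x ->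
  forall K : set (C R), K !=set0 -> compact K -> K `<=` open_disc R ->
    hausdorff_cvg cdist (fun n => mobius_fun (F n) @` K) [set \val x].
Proof.
move=> /cvg_cabsP Fx K K0 cK KD.
have cc : {within K, continuous (@cabs R)}.
  by apply: continuous_subspaceT; exact: continuous_cabs.
have [c Kc cM] := compact_EVT_max K0 cK cc.
have c1 : cabs c < 1 by apply/open_discP/KD; exact: set_mem.
apply/hausdorff_cvg1P.
- exact: cdist_ge0.
- by apply: nearW => n; case: K0 => z Kz; exists (mobius_fun (F n) z), z.
move=> e e0; pose M := 1 + 2 / (1 - cabs c).
have M0 : 0 < M by rewrite addr_gt0// divr_gt0// subr_gt0.
have d0 : 0 < e / M by rewrite divr_gt0.
apply: filterS (Fx _ d0) => n; rewrite ltr_pdivlMr// => wx _ [z Kz <-].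
have zc : cabs z <= cabs c by apply: cM; exact: mem_set.
have z1 : cabs z < 1 by exact: le_lt_trans c1.
have := cabs_triangle (mobius_fun (F n) 0) (mobius_fun (F n) z) (\val x).
have := mobius_funB0_le (F n) z1.
have := onem_sqr_le_dist (cabs_circle x) (ltW (mobius_fun0_lt1 (F n))).
set w := mobius_fun (F n) 0 in wx * => h1 h2 h3.
have : (1 - cabs w ^+ 2) / (1 - cabs z) <= 2 * cabs (w - \val x) / (1 - cabs c).
  apply: ler_pM => //; rewrite ?invr_ge0 ?subr_ge0 ?(ltW z1)//.
  - by rewrite expr_le1// ?cabs_ge0// ltW// mobius_fun0_lt1.
  - by rewrite lef_pV2 ?posrE ?subr_gt0// lerB.
have : cabs (w - \val x) * M = cabs (w - \val x) + 2 * cabs (w - \val x) / (1 - cabs c).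
  by rewrite /M; ring.
move: h2 h3 wx; rewrite /cdist; lra.
Qed.

Lemma compact_image_point_cvg F x :
  (forall K : set (C R), K !=set0 -> compact K -> K `<=` open_disc R ->
    hausdorff_cvg cdist (fun n => mobius_fun (F n) @` K) [set \val x]) ->
  forall z : C R, open_disc R z ->
    mobius_fun (F n) z @[n --> \oo] --> (\val x : C R).
Proof.
move=> FK z Dz; apply/cvg_cabsP => e e0.
have zne : [set z] !=set0 by exists z.
have zD : [set z] `<=` open_disc R by move=> _ ->.
have ne : \forall n \near \oo, (mobius_fun (F n) @` [set z]) !=set0.
  by apply: nearW => n; exists (mobius_fun (F n) z), z.
have := (hausdorff_cvg1P _ cdist_ge0 ne).1 (FK _ zne (@compact_set1 _ z) zD) e e0.
by apply: filterS => n; apply; exists z.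
Qed.

(** By [onem_sqr_mobius_fun_ge] and [mobius_funB0_le], |F(z) - F(0)| is at most
    a multiple of 1 - |F(z)|^2 depending on z only. *)
Lemma point_center_cvg F x :
  (exists2 z : C R, open_disc R z &
    mobius_fun (F n) z @[n --> \oo] --> (\val x : C R)) -> center_cvg F x.
Proof.
move=> [z /open_discP z1 /cvg_cabsP Fx]; apply/cvg_cabsP => e e0.
have z2 : 0 < 1 - cabs z ^+ 2 by rewrite subr_gt0 expr_lt1// cabs_ge0.
have z3 : 0 < 1 - cabs z by rewrite subr_gt0.
pose L := (1 - cabs z) * (1 - cabs z ^+ 2).
have L0 : 0 < L by rewrite mulr_gt0.
pose M := 1 + 8 / L.
have M0 : 0 < M by rewrite addr_gt0// divr_gt0.
have d0 : 0 < e / M by rewrite divr_gt0.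
apply: filterS (Fx _ d0) => n; rewrite ltr_pdivlMr// => wx.
have := cabs_triangle (mobius_fun (F n) z) (mobius_fun (F n) 0) (\val x).
rewrite (cabsBC (mobius_fun (F n) 0) (mobius_fun _ _)).
have := mobius_funB0_le (F n) z1.
have := onem_sqr_mobius_fun_ge (F n) (ltW z1).
have Fz1 : cabs (mobius_fun (F n) z) <= 1.
  rewrite -(@expr_le1 _ 2)// ?cabs_ge0// -subr_ge0 onem_sqr_mobius_fun ?(ltW z1)//.
  by rewrite divr_ge0 ?sqr_ge0 ?(ltW z2).
have := onem_sqr_le_dist (cabs_circle x) Fz1.
set w := mobius_fun (F n) 0; set y := mobius_fun (F n) z in wx Fz1 * => h1 h2 h3 h4.
have : (1 - cabs w ^+ 2) / (1 - cabs z) <= 8 * cabs (y - \val x) / L.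
  rewrite /L invfM mulrA mulrAC ler_wpM2r ?invr_ge0 ?(ltW z3)//.
  by rewrite ler_pdivlMr// mulrC; lra.
have : cabs (y - \val x) * M = cabs (y - \val x) + 8 * cabs (y - \val x) / L.
  by rewrite /M; ring.
lra.
Qed.

End geometry.

Theorem theorem8 (R : realType) (F : nat -> mobius R) (x : circle R)
    (finite_rotations : finite_set [set n | mobius_rotation (F n)]) :
  let V n := expansion_interval (mobius_inv (F n)) in
  let D n := expansion_set (mobius_inv (F n)) in
  let d n := disc_center (D n) in
  let Fmu n := mobius_push (F n) (@circle_measure R) in
  [<->
    represents F x;

    forall I : set (circle R), open_interval I -> I x ->
      Fmu n I @[n --> \oo] --> 1%E;

    exists2 c : R, 0 < c &
      forall I : set (circle R), open_interval I -> I x ->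
        (c%:E < limn_einf (fun n => Fmu n I))%E;

    d n @[n --> \oo] --> (\val x : C R);

    hausdorff_cvg cdist (fun n => finite_part (D n)) [set \val x];

    hausdorff_cvg arc_dist (fun n => closure (V n)) [set x];

    forall K : set (C R), K !=set0 -> compact K -> K `<=` open_disc R ->
      hausdorff_cvg cdist (fun n => mobius_fun (F n) @` K) [set \val x];

    forall z : C R, open_disc R z ->
      mobius_fun (F n) z @[n --> \oo] --> (\val x : C R);

    exists2 z : C R, open_disc R z &
      mobius_fun (F n) z @[n --> \oo] --> (\val x : C R);

    forall e : R, 0 < e ->
      circle_measure [set z : borel_circle R |
        e < arc_dist (mobius_circle (F n) z) x] @[n --> \oo] --> 0%E].
Proof.
move=> V D d Fmu; tfae.
- exact: represents_open_interval.
- exact: open_interval_limn_einf.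
- by move=> /limn_einf_center_cvg; exact: center_disc_center_cvg.
- exact: disc_center_expansion_set_cvg.
- exact: expansion_set_expansion_interval_cvg.
- by move=> /(expansion_interval_center_cvg finite_rotations)/center_compact_image_cvg.
- exact: compact_image_point_cvg.
- by move=> Fz; exists 0; [rewrite /open_disc /= normr0|apply: Fz; rewrite /open_disc /= normr0].
- by move=> /point_center_cvg/center_cvg_in_measure.
- exact: cvg_in_measure_represents.
Qed.
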